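(* Let $T>0$ and let $a,b,c:[0,T]\to\mathbb{R}$ be measurable functions with $a\in L^{p}[0,T]$, $b\in L^{q}[0,T]$, $c\in L^{r}[0,T]$ for some $p\in[2,\infty]$, $q\in[1,\infty]$, $r\in[1,\infty]$ such that $1/p+1/q+1/r\le \frac32$. Put $K(t,s)=a(s)\int_s^t b(u)\,c(u-s)\,du$ for $0\le s\le t\le T$. Then $$\sup_{t\in[0,T]}\|K(t,\cdot)\|_{L^2[0,t]}<\infty,$$ so that the process $X_t=\int_0^t K(t,s)\,dW_s$, $t\in[0,T]$, is well defined. If, in addition, $1/p+1/r<\frac32$, then the process $X=\{X_t,\ t\in[0,T]\}$ has a continuous modification.
   Context: $W=\{W_t,\ t\ge 0\}$ is a standard Wiener process, and $\int_0^t K(t,s)\,dW_s$ is the Wiener integral of the deterministic function $K(t,\cdot)\in L^2[0,t]$. Convention: $1/\infty=0$. *)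

(* Defs.v *)
From HB Require Import structures.
From mathcomp Require Import all_boot all_order all_algebra.
From mathcomp Require Import all_classical all_reals all_analysis.

Set Implicit Arguments.
Unset Strict Implicit.
Unset Printing Implicit Defensive.

Import Order.TTheory GRing.Theory Num.Theory.
Import numFieldNormedType.Exports.

Local Open Scope classical_set_scope.
Local Open Scope ring_scope.

(* Functions on [0, t] are represented by total functions R -> R of which only
   the values on [0, t] matter: [f \_ D] extends the restriction of f to D by
   0.  [Lfun] includes measurability, and its exponent is an extended real, in
   which (+oo)^-1 = 0 and 'N[mu]_+oo is the essential supremum. *)
Definition Lp_on (R : realType) (D : set R) (p : \bar R) (f : R -> R) : Prop :=
  f \_ D \in Lfun (@lebesgue_measure R) p.

Definition norm2_on (R : realType) (D : set R) (f : R -> R) : \bar R :=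
  Lnorm (@lebesgue_measure R) 2%:E (EFin \o f \_ D).

(* [Rintegral] is 0 where the integrand is not Lebesgue integrable. *)
Definition volterra (R : realType) (a b c : R -> R) (t s : R) : R :=
  a s * \int[@lebesgue_measure R]_(u in `[s, t]) (b u * c (u - s)).

Section wiener.
Context {R : realType} {d : measure_display} {Omega : measurableType d}
  {P : probability Omega R}.
Implicit Types W X Y : R -> {RV P >-> R}.

(* Only the values at nonnegative times matter.  The product rule for all
   families (A i) of Borel sets is the mutual independence of the increments,
   as any of the A i may be taken to be the whole line. *)
Definition independent_increments W : Prop :=
  forall (n : nat) (t : nat -> R) (A : nat -> set R),
    0 <= t 0%N -> (forall i, (i < n)%N -> t i <= t i.+1) ->
    (forall i, measurable (A i)) ->
    P [set w | forall i, (i < n)%N -> A i (W (t i.+1) w - W (t i) w)] =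
    (\prod_(i < n) P [set w | A i (W (t i.+1) w - W (t i) w)%R])%E.

(* The second parameter of [normal_prob] is the standard deviation. *)
Definition wiener_process W : Prop :=
  [/\ {ae P, forall w, W 0 w = 0},
      independent_increments W,
      (forall (s t : R) (A : set R), 0 <= s -> s < t -> measurable A ->
        pushforward P (W t \- W s) A = normal_prob 0 (Num.sqrt (t - s)) A) &
      {ae P, forall w, {within `[0, +oo[, continuous (fun t : R => W t w)}}].

(* In the next two definitions, x is the sequence x_1 < ... < x_n of the points
   of a partition with x_0 = 0, in the convention of [itv_partition], and e i
   is the value taken on ]x_i, x_(i+1)]. *)
Definition step_fun (e : nat -> R) (x : seq R) (s : R) : R :=
  \sum_(i < size x) e i * \1_(`](0 :: x)`_i, (0 :: x)`_i.+1]%classic) s.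

Definition step_integral W (e : nat -> R) (x : seq R) (w : Omega) : R :=
  \sum_(i < size x) e i * (W (0 :: x)`_i.+1 w - W (0 :: x)`_i w).

(* Y is (a version of) the integral of f dW over [0, t]: the L^2(P)-limit of
   the integrals of step functions that converge to f in L^2[0, t]. *)
Definition is_wiener_integral W (t : R) (f : R -> R) (Y : {RV P >-> R}) : Prop :=
  Lp_on `[0, t] 2%:E f /\
  exists (e : nat -> nat -> R) (x : nat -> seq R),
    [/\ forall n, itv_partition 0 t (x n),
        (fun n => norm2_on `[0, t] (f \- step_fun (e n) (x n))) @ \oo --> 0%E &
        (fun n => Lnorm P 2%:E (fun w =>
           (Y w - step_integral W (e n) (x n) w)%:E)) @ \oo --> 0%E].

Definition modification_on (D : set R) X Y : Prop :=
  forall t, D t -> {ae P, forall w, X t w = Y t w}.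

End wiener.

(* Main.v *)
Require Import Defs.
From HB Require Import structures.
From mathcomp Require Import all_boot all_order all_algebra.
From mathcomp Require Import all_classical all_reals all_analysis.
From mathcomp Require Import measurable_realfun ess_sup_inf zify ring lra.

Set Implicit Arguments.
Unset Strict Implicit.
Unset Printing Implicit Defensive.

Import Order.TTheory GRing.Theory Num.Theory.
Import numFieldNormedType.Exports.

Local Open Scope classical_set_scope.
Local Open Scope ring_scope.

(* Put |a| <= A beta^x, |b| <= B gamma^y, |c| <= C delta^z almost everywhere on
   [0, T], where beta, gamma, delta are densities of mass 1, x = 1/p, y and z
   are at least 1/q and 1/r, and x + y + z = 3/2.  For positive numbers
   (beta^x gamma^y delta^z)^2 <= (beta gamma + beta delta + gamma delta)
   (gamma + delta), so that the Cauchy-Schwarz inequality in u and the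
   translation invariance of the Lebesgue measure bound the L^2 norm of
   s |-> a(s) int_I b(u) c(u - s) du by a constant times (int_I gamma)^y.  This
   gives the uniform bound (I = [0, t]) and a bound on the increments of the
   kernel (I = ]t', t]), in which y can be taken positive exactly when
   1/p + 1/r < 3/2.

   The exponential moments of a finite sum of values of W are explicit, hence
   its moment of order 2m is at most C_m sigma^2m, where sigma is the L^2 norm
   of the corresponding step function.  This inequality passes to L^2-limits;
   with m = 1 it yields the existence and the uniqueness of the Wiener
   integrals, and with m large it makes X satisfy Kolmogorov's criterion with
   respect to the time change t |-> t + int_0^t gamma. *)

(** * Expectations of products of independent variables *)

(** Densities put all Lebesgue exponents, infinite ones included, on the same footing. On a bounded
    interval the majorant of |f| may be taken at least 1 before it is normalized, so its exponent
    may be raised. This turns 1/p + 1/q + 1/r <= 3/2 into an equation, without which the pointwise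
    inequality would not be homogeneous.

    The kernel increments are bounded by a power y of an increment of t |-> int_0^t gamma, where y
    may be small and this function, though continuous, need not have a Hoelder modulus. High moments
    make up for the first, the change of time for the second.

    The inner integral of the kernel has to be finite for almost every s, also where a vanishes. The
    bounds are therefore proved with the positive majorant beta^x as weight, and a enters only
    afterwards. *)

Section weighted_integral.
Local Open Scope ereal_scope.
Import HBNNSimple.

Lemma integral_nnsfun_weight {R : realType} d (T : measurableType d)
    (mu : {measure set T -> \bar R}) (X k : T -> R) (g : {nnsfun R >-> R}) :
  measurable_fun setT X -> measurable_fun setT k -> (forall w, (0 <= k w)%R) ->
  \int[mu]_w (g (X w) * k w)%:E = \sum_(r \in range g)
    `|r|%:E * \int[mu]_w (\1_(g @^-1` [set r]) (X w) * k w)%:E.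
Proof.
move=> mX mk k0.
transitivity (\int[mu]_w \sum_(r \in range g)
    (`|r| * (\1_(g @^-1` [set r]) (X w) * k w))%:E).
  apply: eq_integral => w _.
  rewrite fsumEFin//; congr EFin; rewrite {1}fimfunE.
  rewrite fsbig_finite//= fsbig_finite//= big_distrl/=.
  apply: eq_big_seq => r; rewrite in_fset_set// inE => -[x _ <-].
  by rewrite mulrA ger0_norm.
have m1 r : measurable_fun setT (fun w => \1_(g @^-1` [set r]) (X w) * k w)%R.
  apply: measurable_funM => //.
  by apply: measurableT_comp => //; exact: measurable_indic.
rewrite ge0_integral_fsum//; last 2 first.
- by move=> r; apply/measurable_EFinP; apply: measurable_funM.
- by move=> r w _; rewrite lee_fin !mulr_ge0.
apply: eq_fsbigr => r _; under eq_integral do rewrite EFinM.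
rewrite ge0_integralZl_EFin//; last exact/measurable_EFinP.
by move=> w _; rewrite lee_fin !mulr_ge0.
Qed.

Lemma cvg_integral_nnsfun_approx {R : realType} d (T : measurableType d)
    (mu : {measure set T -> \bar R}) (X k : T -> R) (f : R -> R)
    (mf : measurable_fun setT (EFin \o f)) :
  measurable_fun setT X -> measurable_fun setT k -> (forall w, (0 <= k w)%R) ->
  (forall x, (0 <= f x)%R) ->
  \int[mu]_w (nnsfun_approx measurableT mf n (X w) * k w)%:E @[n --> \oo] -->
  \int[mu]_w (f (X w) * k w)%:E.
Proof.
move=> mX mk k0 f0.
set g := nnsfun_approx measurableT mf.
have gf x : EFin \o g ^~ x @ \oo --> (f x)%:E.
  by apply: cvg_nnsfun_approx => // y _; rewrite lee_fin.
rewrite [X in _ --> X](_ : _ = \int[mu]_w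
    limn (fun n => (g n (X w) * k w)%:E)); last first.
  apply: eq_integral => w _; apply/esym/cvg_lim => //.
  under eq_fun do rewrite EFinM.
  by rewrite EFinM; apply: cvgeZr => //; exact: gf.
apply: cvg_monotone_convergence => //.
- move=> n; apply/measurable_EFinP; apply: measurable_funM => //.
  by apply: measurableT_comp.
- by move=> n w _; rewrite lee_fin mulr_ge0.
- move=> w _ m n mn; rewrite lee_fin ler_wpM2r//.
  exact/lefP/nd_nnsfun_approx.
Qed.

(** The weights let this serve twice: with the normal density on one side it passes from the law of
    an increment to a Lebesgue integral, and with the product of the other factors as weight it
    exchanges a single factor in the expectation of a product. *)
Lemma ge0_integral_weight {R : realType} d1 d2 (T1 : measurableType d1)
    (T2 : measurableType d2) (mu1 : {measure set T1 -> \bar R})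
    (mu2 : {measure set T2 -> \bar R})
    (X1 h1 : T1 -> R) (X2 h2 : T2 -> R) :
  measurable_fun setT X1 -> measurable_fun setT h1 -> (forall w, (0 <= h1 w)%R) ->
  measurable_fun setT X2 -> measurable_fun setT h2 -> (forall w, (0 <= h2 w)%R) ->
  (forall A, measurable A ->
    \int[mu1]_w (\1_A (X1 w) * h1 w)%:E = \int[mu2]_w (\1_A (X2 w) * h2 w)%:E) ->
  forall f : R -> R, measurable_fun setT f -> (forall x, (0 <= f x)%R) ->
  \int[mu1]_w (f (X1 w) * h1 w)%:E = \int[mu2]_w (f (X2 w) * h2 w)%:E.
Proof.
move=> mX1 mh1 h10 mX2 mh2 h20 hA f mf f0.
have mf' : measurable_fun setT (EFin \o f) by exact/measurable_EFinP.
have /cvg_lim <- // := @cvg_integral_nnsfun_approx _ _ _ mu1 _ _ _ mf' mX1 mh1 h10 f0.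
have /cvg_lim <- // := @cvg_integral_nnsfun_approx _ _ _ mu2 _ _ _ mf' mX2 mh2 h20 f0.
congr (limn _); apply/funext => n.
rewrite !integral_nnsfun_weight//.
by apply: eq_fsbigr => r _; rewrite hA//; exact: measurable_funPTI.
Qed.

End weighted_integral.

Section independence.
Local Open Scope ereal_scope.
Context {R : realType} d (Omega : measurableType d) (P : probability Omega R).

Lemma integral_prod_independent (n : nat) (xi : nat -> Omega -> R) :
  (forall i, measurable_fun setT (xi i)) ->
  (forall A : nat -> set R, (forall i, measurable (A i)) ->
    P [set w | forall i, (i < n)%N -> A i (xi i w)] =
    \prod_(i < n) P [set w | A i (xi i w)]) ->
  forall (f : nat -> R -> R) (e : nat -> R),
  (forall i, measurable_fun setT (f i)) -> (forall i x, (0 <= f i x)%R) ->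
  (forall i, \int[P]_w (f i (xi i w))%:E = (e i)%:E) ->
  \int[P]_w (\prod_(i < n) f i (xi i w))%:E = (\prod_(i < n) e i)%:E.
Proof.
move=> mxi indep f e mf f0 fe.
have mxiA i A : measurable A -> measurable [set w | A (xi i w)].
  by move=> mA; rewrite -[X in measurable X]setTI; exact: mxi.
suff H k : forall (f : nat -> R -> R) (e : nat -> R),
    (forall i, measurable_fun setT (f i)) -> (forall i x, (0 <= f i x)%R) ->
    (forall i, \int[P]_w (f i (xi i w))%:E = (e i)%:E) ->
    (forall i, (k <= i < n)%N -> exists2 A, measurable A & f i = \1_A) ->
    \int[P]_w (\prod_(i < n) f i (xi i w))%:E = (\prod_(i < n) e i)%:E.
  by apply: (H n) => // i /andP[a b]; move: (leq_ltn_trans a b); rewrite ltnn.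
(* The f i are replaced by arbitrary functions one at a time, starting from
   indicators. *)
elim: k => [|k IH] {mf f0 fe}f {}e mf f0 fe fA.
  have /choice[A HA] i : exists A : set R, measurable A /\ ((i < n)%N -> f i = \1_A).
    have [i_n|] := boolP (i < n)%N; last by exists set0.
    by have [//|A mA ->] := fA i; exists A.
  have mA i : measurable (A i) by have [] := HA i.
  transitivity (\int[P]_w (\1_[set w | forall i, (i < n)%N -> A i (xi i w)] w)%:E).
    apply: eq_integral => w _; congr EFin.
    under eq_bigr => i _ do rewrite (HA i).2// indicE.
    rewrite indicE; have [h|h] := pselect (forall i, (i < n)%N -> A i (xi i w)).
      by rewrite mem_set// big1// => i _; rewrite mem_set//; apply: h.
    rewrite memNset//.
    move/existsNP : h => [i /not_implyP[i_n Ai]].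
    by rewrite (bigD1 (Ordinal i_n))//= memNset//= mul0r.
  rewrite integral_indic ?setIT//; last first.
    rewrite (_ : mkset _ = \bigcap_(i in `I_n) [set w | A i (xi i w)])//.
    by apply: fin_bigcap_measurable => // i _; exact: mxiA.
  rewrite [LHS](indep A)// -prodEFin; apply: eq_bigr => i _.
  rewrite -fe (HA i).2//.
  transitivity (\int[P]_w (\1_[set w | A i (xi i w)] w)%:E).
    by rewrite integral_indic ?setIT//; exact: mxiA.
  by apply: eq_integral => w _; rewrite !indicE.
have [kn|nk] := ltnP k n; last first.
  apply: IH => // i /andP[ki i_n].
  by have := leq_trans nk ki; rewrite leqNgt i_n.
pose kk := Ordinal kn.
pose h w := (\prod_(i < n | i != kk) f i (xi i w))%R.
pose c := (\prod_(i < n | i != kk) e i)%R.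
have e0 i : (0 <= e i)%R.
  by rewrite -lee_fin -fe integral_ge0// => w _; rewrite lee_fin.
under eq_integral do rewrite (bigD1 kk)//=.
rewrite (bigD1 kk)//= EFinM -(fe k).
have eqc (f1 : R -> R) : measurable_fun setT f1 -> (forall x, (0 <= f1 x)%R) ->
    \int[P]_w (f1 (xi k w) * c)%:E = \int[P]_w (f1 (xi k w))%:E * c%:E.
  move=> mf1 f10; under eq_integral do rewrite EFinM.
  rewrite ge0_integralZr//.
  - by apply/measurable_EFinP; exact: measurableT_comp.
  - by move=> w _; rewrite lee_fin.
  - by rewrite lee_fin; apply: prodr_ge0.
rewrite -eqc//.
(* All factors but the one of index k become a weight: the random [h] on the left, the constant [c]
   on the right. What remains is an indicator in place k, which the induction hypothesis covers. *)
apply: (@ge0_integral_weight _ _ _ _ _ P P (xi k) h (xi k) (cst c)) => //.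
- rewrite /h; under eq_fun do rewrite -big_filter.
  apply: measurable_prod => i _.
  by apply: measurableT_comp.
- by move=> w; apply: prodr_ge0 => *.
- by move=> w; apply: prodr_ge0 => *.
move=> A mA; rewrite eqc//.
have AE : \int[P]_w (\1_A (xi k w))%:E = P [set w | A (xi k w)].
  transitivity (\int[P]_w (\1_[set w | A (xi k w)] w)%:E).
    by apply: eq_integral => w _; rewrite !indicE.
  by rewrite integral_indic ?setIT//; exact: mxiA.
have fin : \int[P]_w (\1_A (xi k w))%:E \is a fin_num.
  by rewrite AE; apply: fin_num_measure; exact: mxiA.
have [f' [f'k f'i]] : exists f' : nat -> R -> R,
    f' k = \1_A /\ forall i, i != k -> f' i = f i.
  exists (fun i => if i == k then \1_A else f i).
  by split => [|i /negbTE ->//]; rewrite eqxx.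
have [e' [e'k e'i]] : exists e' : nat -> R,
    (e' k)%:E = \int[P]_w (\1_A (xi k w))%:E /\ forall i, i != k -> e' i = e i.
  exists (fun i => if i == k then fine (\int[P]_w (\1_A (xi k w))%:E) else e i).
  by split => [|i /negbTE ->//]; rewrite eqxx fineK.
have IH' := IH f' e'.
have cE : c = (\prod_(i < n | i != kk) e' i)%R.
  by apply: eq_bigr => i ik; rewrite e'i.
have hE w : h w = (\prod_(i < n | i != kk) f' i (xi i w))%R.
  by apply: eq_bigr => i ik; rewrite f'i.
rewrite cE -e'k -EFinM.
transitivity (\prod_(i < n) e' i)%:E; last by rewrite (bigD1 kk).
rewrite -IH'.
- apply: eq_integral => w _.
  by rewrite [in RHS](bigD1 kk)//= f'k hE.
- move=> i; have [->|ik] := eqVneq i k; last by rewrite f'i.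
  by rewrite f'k; exact: measurable_indic.
- by move=> i x; have [->|ik] := eqVneq i k; [rewrite f'k|rewrite f'i].
- by move=> i; have [->|ik] := eqVneq i k; [rewrite f'k e'k|rewrite f'i// e'i].
- move=> i /andP[ki i_n]; have [->|ik] := eqVneq i k; first by exists A.
  by rewrite f'i//; apply: fA; rewrite i_n andbT ltn_neqAle eq_sym ik.
Qed.

End independence.

(** * Finite Wiener sums *)

Section gaussian.
Context {R : realType} {d : measure_display} {Omega : measurableType d}
  {P : probability Omega R}.
Local Notation mu := (@lebesgue_measure R).

(** Completing the square: up to the constant, the integrand is the normal density with mean l
    s^2. *)
Lemma integral_expR_normal (l s : R) : s != 0 ->
  (\int[mu]_x (expR (l * x) * normal_pdf 0 s x)%:E = (expR (l ^+ 2 * s ^+ 2 / 2))%:E)%E.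
Proof.
move=> s0.
transitivity (\int[mu]_x ((expR (l ^+ 2 * s ^+ 2 / 2))%:E *
    (normal_pdf (l * s ^+ 2) s x)%:E))%E.
  apply: eq_integral => x _; rewrite -EFinM; congr EFin.
  rewrite !normal_pdfE// /normal_fun.
  rewrite mulrCA [RHS]mulrCA -!expRD; congr (_ * expR _).
  by rewrite -mulr_natr; field.
rewrite ge0_integralZl//.
- by rewrite integral_normal_pdf mule1.
- by apply/measurable_EFinP; exact: measurable_normal_pdf.
- by move=> x _; rewrite lee_fin normal_pdf_ge0.
Qed.

Lemma wiener_increment_mgf (W : R -> {RV P >-> R}) (s t l : R) :
  wiener_process W -> 0 <= s <= t ->
  (\int[P]_w (expR (l * (W t w - W s w)))%:E =
   (expR (l ^+ 2 * (t - s) / 2))%:E)%E.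
Proof.
move=> [_ _ hN _] /andP[s0]; rewrite le_eqVlt => /predU1P[->|st].
  (* The law of an increment is prescribed for s < t only, so s = t is treated apart. *)
  rewrite subrr mulr0 mul0r expR0.
  under eq_integral do rewrite subrr mulr0 expR0.
  by rewrite integral_cst//= mul1e probability_setT.
have ts0 : 0 < t - s by rewrite subr_gt0.
transitivity (\int[P]_w (expR (l * (W t \- W s) w) * cst 1 w)%:E)%E.
  by apply: eq_integral => w _; rewrite mulr1.
transitivity (\int[mu]_x (expR (l * id x) *
    normal_pdf 0 (Num.sqrt (t - s)) x)%:E)%E; last first.
  by rewrite integral_expR_normal ?sqr_sqrtr ?ltW// gt_eqF// sqrtr_gt0.
apply: (@ge0_integral_weight _ _ _ _ _ P mu (W t \- W s) (cst 1) id
  (normal_pdf 0 (Num.sqrt (t - s))) _ _ _ _ _ _ _ (fun x => expR (l * x))) => //.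
- exact: measurable_normal_pdf.
- by move=> x; exact: normal_pdf_ge0.
- move=> A mA.
  transitivity (\int[P]_w (\1_((W t \- W s) @^-1` A) w)%:E)%E.
    by apply: eq_integral => w _; rewrite mulr1.
  rewrite integral_indic//; last first.
    rewrite -[X in measurable X]setTI.
    by apply: (measurable_funB (measurable_funP _) (measurable_funP _)).
  rewrite setIT [LHS](hN s t A)// /normal_prob [LHS]integral_mkcond.
  apply: eq_integral => x _; rewrite /patch indicE.
  by case: ifPn => xA; rewrite ?mul1r ?mul0r.
- by apply: measurableT_comp => //; exact: mulrl_measurable.
Qed.

Lemma wiener_grid_mgf (W : R -> {RV P >-> R}) (y a : nat -> R) (n : nat) :
  wiener_process W -> 0 <= y 0 -> {homo y : i j / (i <= j)%N >-> i <= j} ->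
  (\int[P]_w (expR (\sum_(i < n) a i * (W (y i.+1) w - W (y i) w)))%:E =
   (expR ((\sum_(i < n) a i ^+ 2 * (y i.+1 - y i)) / 2))%:E)%E.
Proof.
move=> hW y0 yh.
have [_ ind _ _] := hW.
have y_ge0 i : 0 <= y i by rewrite (le_trans y0)// yh.
under eq_integral do rewrite expR_sum.
rewrite mulr_suml expR_sum.
apply: (@integral_prod_independent _ _ _ P n (fun i => W (y i.+1) \- W (y i)) _ _
  (fun i x => expR (a i * x)) (fun i => expR (a i ^+ 2 * (y i.+1 - y i) / 2))).
- by move=> i; exact: measurable_funB.
- by move=> A mA; apply: ind => // i _; exact: yh.
- by move=> i; apply: measurableT_comp => //; exact: mulrl_measurable.
- by move=> i x; exact: expR_ge0.
- by move=> i; apply: wiener_increment_mgf => //; rewrite y_ge0 yh.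
Qed.


(* The pairs (alpha, t) of the list l stand for the terms alpha W_t, and
   alpha W_t is the integral of alpha 1_]0, t] with respect to W. *)
Definition wiener_sum (W : R -> {RV P >-> R}) (l : seq (R * R)) (w : Omega) : R :=
  \sum_(p <- l) p.1 * W p.2 w.

Definition wiener_sum_kernel (l : seq (R * R)) (s : R) : R :=
  \sum_(p <- l) p.1 * \1_(`]0, p.2]%classic) s.

Lemma measurable_wiener_sum (W : R -> {RV P >-> R}) (l : seq (R * R)) :
  measurable_fun setT (wiener_sum W l).
Proof. by apply: measurable_sum => p; apply: measurable_funM. Qed.

(** The coefficients of the increments do not depend on F, so one set of them serves both a path of
    W and an indicator. They compare values of y and not indices; when the grid has repetitions, the
    additional terms with i >= k have a zero increment. *)
Lemma telescope_grid (y : nat -> R) (n k : nat) (F : R -> R) :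
  {homo y : i j / (i <= j)%N >-> i <= j} -> (k <= n)%N ->
  F (y k) = F (y 0) + \sum_(i < n) (y i.+1 <= y k)%R%:R * (F (y i.+1) - F (y i)).
Proof.
move=> yh kn.
rewrite -(big_mkord xpredT (fun i => (y i.+1 <= y k)%R%:R * (F (y i.+1) - F (y i)))).
rewrite (big_cat_nat (leq0n k) kn)/= [X in _ + (_ + X)]big1_seq ?addr0; last first.
  move=> i /=; rewrite mem_index_iota => /andP[ki i_n].
  have [h|_] := boolP (y i.+1 <= y k); last by rewrite mul0r.
  have e1 : y i.+1 = y k.
    by apply/eqP; rewrite eq_le h/= yh// (leq_trans ki).
  have e2 : y i = y k.
    by apply/eqP; rewrite eq_le (yh _ _ ki) andbT -e1 yh.
  by rewrite e1 e2 subrr mulr0.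
rewrite (eq_big_nat _ _ (F2 := fun i => F (y i.+1) - F (y i))); last first.
  by move=> i /andP[_ ik]; rewrite yh// mul1r.
by rewrite telescope_sumr// addrC subrK.
Qed.

Lemma exists_grid (l : seq (R * R)) : (forall p, p \in l -> 0 <= p.2) ->
  exists n (y : nat -> R), [/\ y 0%N = 0,
    {homo y : i j / (i <= j)%N >-> i <= j} &
    forall p, p \in l -> exists2 k, (k <= n)%N & p.2 = y k].
Proof.
move=> l0.
pose s := sort <=%R (0 :: map snd l).
have ss : sorted <=%R s by apply: sort_sorted; exact: le_total.
have szs : size s = (size l).+1 by rewrite size_sort/= size_map.
have ms x : (x \in s) = (x \in 0 :: map snd l) by rewrite mem_sort.
(* Constant beyond the last point, so that y is monotone on all of nat. *)
pose y i := s`_(minn i (size l)).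
have yh : {homo y : i j / (i <= j)%N >-> i <= j}.
  move=> i j ij; rewrite /y.
  apply: (sorted_leq_nth le_trans le_refl 0 ss); rewrite ?inE ?szs ?ltnS ?geq_minr//.
  lia.
exists (size l), y; split => //.
- have y0 : 0 <= y 0.
    have : y 0 \in s by apply: mem_nth; rewrite szs ltnS geq_minr.
    rewrite ms inE => /predU1P[->//|/mapP[p pl ->]]; exact: l0.
  apply/eqP; rewrite eq_le y0 andbT.
  have /(nthP 0)[k ks <-] : 0 \in s by rewrite ms inE eqxx.
  rewrite szs ltnS in ks.
  by rewrite [leRHS](_ : _ = y k) ?yh// /y (minn_idPl ks).
- move=> p pl.
  have /(nthP 0)[k ks <-] : p.2 \in s.
    by rewrite ms inE; apply/orP; right; apply/mapP; exists p.
  rewrite szs ltnS in ks; exists k => //.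
  by rewrite /y (minn_idPl ks).
Qed.

Lemma sum_sqr_orthogonal (n : nat) (u : nat -> R) :
  (forall i j, (i < j)%N -> u i * u j = 0) ->
  (\sum_(i < n) u i) ^+ 2 = \sum_(i < n) u i ^+ 2.
Proof.
move=> ort; rewrite expr2 big_distrl/=; apply: eq_bigr => i _.
rewrite big_distrr/= (bigD1 i)//= big1 ?addr0// => j ji.
have [ij|ij|/val_inj ij] := ltngtP i j; first exact: ort.
  by rewrite mulrC ort.
by rewrite ij eqxx in ji.
Qed.

Lemma indic_itv0_sub (u v s : R) : 0 <= u <= v ->
  \1_(`]0, v]%classic) s - \1_(`]0, u]%classic) s = \1_(`]u, v]%classic) s :> R.
Proof.
move=> /andP[u0 uv]; rewrite !indicE !mem_setE !in_itv/=.
have [s0|s0] := ltP 0 s; have [h1|h1] := leP s v;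
  have [h2|h2] := leP s u => /=; rewrite ?subrr ?subr0//.
  by move: uv; rewrite leNgt (lt_le_trans h1 h2).
by move: u0; rewrite leNgt (lt_le_trans h2 s0).
Qed.

(** The Ito isometry for step functions: on a common grid the sum is a combination of independent
    increments and its kernel the same combination of disjoint indicators, so that one number v is
    both the variance and the squared norm. *)
Lemma wiener_sum_mgf (W : R -> {RV P >-> R}) (l : seq (R * R)) :
  wiener_process W -> (forall p, p \in l -> 0 <= p.2) ->
  exists v : R, (\int[mu]_s (wiener_sum_kernel l s ^+ 2)%:E = v%:E)%E /\
  forall c : R, (\int[P]_w (expR (c * wiener_sum W l w))%:E =
    (expR (c ^+ 2 * v / 2))%:E)%E.
Proof.
move=> hW l0.
have [n [y [y0 yh ly]]] := exists_grid l0.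
pose A i := \sum_(p <- l) p.1 * (y i.+1 <= p.2)%R%:R.
(* Used with F the indicator of ]0, t] at s as a function of t, and with F a path of W; both vanish
   at 0, the path almost surely. *)
have linE F : \sum_(p <- l) p.1 * F p.2 =
    (\sum_(p <- l) p.1) * F 0 + \sum_(i < n) A i * (F (y i.+1) - F (y i)).
  under [X in _ = _ + X]eq_bigr do rewrite big_distrl/=.
  rewrite exchange_big/= big_distrl/= -big_split/=.
  apply: eq_big_seq => p /ly[k kn ->].
  rewrite [in LHS](telescope_grid F yh kn) y0 mulrDr; congr (_ + _).
  by rewrite big_distrr/=; apply: eq_bigr => i _; rewrite mulrA.
pose v := \sum_(i < n) A i ^+ 2 * (y i.+1 - y i).
have y_ge0 i : 0 <= y i by rewrite -y0 yh.
exists v; split.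
  transitivity (\int[mu]_s (\sum_(i < n)
      (A i ^+ 2 * \1_(`]y i, y i.+1]%classic) s)%:E))%E.
    apply: eq_integral => s _.
    rewrite sumEFin; congr EFin.
    rewrite /wiener_sum_kernel (linE (fun t => \1_(`]0, t]%classic) s)).
    rewrite [in X in _ * X]set_itvoc0 indic0 mulr0 add0r.
    under eq_bigr do rewrite indic_itv0_sub ?y_ge0 ?yh//.
    rewrite (sum_sqr_orthogonal n (u := fun i => A i * \1_(`]y i, y i.+1]%classic) s)).
      apply: eq_bigr => i _; rewrite exprMn; congr (_ * _).
      by rewrite indicE; case: (_ \in _); rewrite ?expr1n ?expr0n.
    move=> i j ij; rewrite mulrACA !indicE !mem_setE !in_itv/=.
    have := yh i.+1 j ij => h.
    have [h1|] := leP s (y i.+1); last by rewrite andbF mul0r mulr0.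
    by rewrite [y j < s]ltNge (le_trans h1 h)/= !mulr0.
  rewrite ge0_integral_sum//.
  - rewrite -sumEFin; apply: eq_bigr => i _.
    under eq_integral do rewrite EFinM.
    rewrite ge0_integralZl//.
    + rewrite integral_indic// setIT [in RHS]EFinM; congr (_ * _)%E.
      have := yh i i.+1 (leqnSn _); rewrite le_eqVlt => /predU1P[->|h].
        by rewrite set_itvoc0 measure0 subrr.
      by rewrite [LHS]lebesgue_measure_itv/= lte_fin h.
    + by apply/measurable_EFinP; exact: measurable_indic.
    + by rewrite lee_fin sqr_ge0.
  - by move=> i; apply/measurable_EFinP; apply: measurable_funM.
  - by move=> i s _; rewrite lee_fin mulr_ge0// sqr_ge0.
move=> c.
rewrite /v mulr_sumr.
under eq_bigr do rewrite mulrA -exprMn.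
rewrite -(wiener_grid_mgf (fun i => c * A i) n hW _ yh); last by rewrite y0.
have [W0 _ _ _] := hW.
apply: ae_eq_integral => //.
- apply/measurable_EFinP; apply: measurableT_comp => //.
  by apply: measurable_funM => //; exact: measurable_wiener_sum.
- apply/measurable_EFinP; apply: measurableT_comp => //.
  apply: measurable_sum => i; apply: measurable_funM => //.
  exact: measurable_funB.
apply: filterS W0 => w W0 _.
rewrite /wiener_sum (linE (W ^~ w)) W0 mulr0 add0r mulr_sumr.
by under eq_bigr do rewrite mulrA.
Qed.

(** The k-th power of y / k <= exp (y / k), for k = 2n and y = |x|. *)
Lemma pow_le_expR (n : nat) (x : R) :
  x ^+ (n.*2) <= (n.*2)%:R ^+ (n.*2) * (expR x + expR (- x)).
Proof.
suff H (y : R) (k : nat) : 0 <= y -> y ^+ k <= k%:R ^+ k * expR y.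
  have -> : x ^+ n.*2 = `|x| ^+ n.*2 by rewrite -normrX ger0_norm// exprn_even_ge0// odd_double.
  apply: (le_trans (H _ _ (normr_ge0 x))).
  rewrite ler_wpM2l ?exprn_ge0//.
  by case: (ger0P x) => _; rewrite ?lerDl ?lerDr expR_ge0.
case: k => [|k] y0; first by rewrite !expr0 mul1r (le_trans _ (expR_ge1Dx _))// lerDl.
have -> : y = k.+1%:R * (y / k.+1%:R) by rewrite mulrC divfK.
rewrite exprMn expRM_natl ler_wpM2l ?exprn_ge0//.
rewrite lerXn2r ?nnegrE ?divr_ge0 ?expR_ge0//.
by rewrite (le_trans _ (expR_ge1Dx _))// lerDr.
Qed.

Lemma wiener_sum_moment (W : R -> {RV P >-> R}) (m : nat) :
  wiener_process W -> exists2 C : R, 0 < C &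
  forall (l : seq (R * R)) (v : R), (forall p, p \in l -> 0 <= p.2) -> 0 < v ->
  (\int[mu]_s (wiener_sum_kernel l s ^+ 2)%:E <= v%:E)%E ->
  (\int[P]_w (wiener_sum W l w ^+ m.*2)%:E <= (C * v ^+ m)%:E)%E.
Proof.
move=> hW.
pose C := (m.*2)%:R ^+ (m.*2) * (expR 2^-1 + expR 2^-1) : R.
have C0 : 0 < C.
  rewrite mulr_gt0 ?addr_gt0 ?expR_gt0//.
  by rewrite -natrX ltr0n expn_gt0 lt0n orNb.
exists C => // l v l0 v0.
have [v' [vE mgf]] := wiener_sum_mgf hW l0; rewrite vE lee_fin => v'v.
have v'0 : 0 <= v'.
  by rewrite -lee_fin -vE integral_ge0// => s _; rewrite lee_fin sqr_ge0.
(* The sum is scaled by the bound v and not by the variance v', which may be 0; since v' <= v, both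
   exponential moments are at most exp (1/2). *)
pose k := (Num.sqrt v)^-1.
have k2 : k ^+ 2 = v^-1 by rewrite /k exprVn sqr_sqrtr// ltW.
have mS := measurable_wiener_sum W l.
have mE c : measurable_fun setT (fun w => (expR (c * wiener_sum W l w))%:E).
  apply/measurable_EFinP; apply: measurableT_comp => //.
  exact: measurable_funM.
apply: (@le_trans _ _ (\int[P]_w ((v ^+ m * (m.*2)%:R ^+ (m.*2))%:E *
   ((expR (k * wiener_sum W l w))%:E + (expR (- k * wiener_sum W l w))%:E)))%E).
  apply: ge0_le_integral => //.
  - by move=> w _; rewrite lee_fin exprn_even_ge0// odd_double.
  - by apply/measurable_EFinP; exact: measurable_funX.
  - by apply: emeasurable_funM => //; apply: emeasurable_funD.
  - move=> w _; rewrite -EFinD -EFinM lee_fin.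
    rewrite -mulrA mulNr (le_trans _ (ler_wpM2l _ (pow_le_expR _ _))) ?exprn_ge0 ?(ltW v0)//.
    rewrite exprMn mulrA -!mul2n !exprM k2 -exprMn mulfV ?gt_eqF// expr1n mul1r//.
rewrite ge0_integralZl//; last 3 first.
- by apply: emeasurable_funD.
- by move=> w _; rewrite -EFinD lee_fin addr_ge0 ?expR_ge0.
- by rewrite lee_fin mulr_ge0 ?exprn_ge0 ?(ltW v0).
rewrite ge0_integralD//.
rewrite !mgf -EFinD -EFinM lee_fin sqrrN k2.
have e : expR (v^-1 * v' / 2) <= expR 2^-1.
  by rewrite ler_expR ler_pdivrMr// mulVf// mulrC ler_pdivrMr// mul1r.
rewrite /C [leRHS]mulrC mulrA ler_wpM2l ?lerD//.
by rewrite mulr_ge0 ?exprn_ge0 ?(ltW v0).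
Qed.

End gaussian.

(** * Almost everywhere convergence from geometric bounds *)

Section summability.
Context {R : realType}.

Lemma geometric_cauchy_cvg (u : R^nat) (M q : R) : 0 <= M -> 0 < q < 1 ->
  (forall n, `|u n.+1 - u n| <= M * q ^+ n) ->
  exists l, u @ \oo --> l /\ forall n, `|u n - l| <= M * q ^+ n / (1 - q).
Proof.
move=> M0 /andP[q0 q1] uq.
have q1' : 0 < 1 - q by rewrite subr_gt0.
have H n m : (n <= m)%N -> `|u m - u n| <= M * q ^+ n / (1 - q).
  move=> nm; rewrite -(subnK nm) addnC.
  have : `|u (n + (m - n))%N - u n| <= M * (q ^+ n - q ^+ (n + (m - n))) / (1 - q).
    elim: (m - n)%N => [|k IH]; first by rewrite addn0 !subrr normr0 mulr0 mul0r.
    rewrite addnS -[X in `|X|](subrKA (u (n + k)%N)).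
    apply: (le_trans (ler_normD _ _)); apply: (le_trans (lerD (uq _) IH)).
    rewrite le_eqVlt; apply/orP; left; apply/eqP.
    by rewrite exprS; field; rewrite gt_eqF.
  move=> /le_trans; apply.
  rewrite ler_pM2r ?invr_gt0// ler_wpM2l// gerBl exprn_ge0// ltW//.
have cq : M * q ^+ n / (1 - q) @[n --> \oo] --> (0 : R).
  rewrite -[X in _ --> X](mul0r (1 - q)^-1); apply: cvgMl.
  by apply: cvg_geometric; rewrite gtr0_norm.
have cu : cvgn u.
  apply/cauchy_cvgP/cauchy_exP => e e0.
  have /cvgrPdist_lt/(_ e e0)[N _ HN] := cq.
  exists (u N); exists N => // n /= Nn.
  rewrite /ball/= distrC; apply: (le_lt_trans (H _ _ Nn)).
  have := HN N (leqnn N); rewrite /= sub0r normrN; apply: le_lt_trans.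
  exact: ler_norm.
exists (limn u); split => // n.
have cn : `|u n - u m| @[m --> \oo] --> `|u n - limn u|.
  by apply: cvg_norm; apply: cvgB => //; exact: cvg_cst.
rewrite -(cvg_lim _ cn)//; apply: limr_le; first by apply/cvg_ex; eexists; exact: cn.
by exists n => // m /= nm; rewrite distrC H.
Qed.

Lemma ge0_cvge0P (u : (\bar R)^nat) : (forall n, (0 <= u n)%E) ->
  u @ \oo --> 0%E <->
  (forall e, 0 < e -> exists N, forall n, (N <= n)%N -> (u n <= e%:E)%E).
Proof.
move=> u0; split => [/fine_cvgP[[N1 _ fin] /cvgrPdist_le cu] e e0|H].
  have [N2 _ HN2] := cu e e0.
  exists (maxn N1 N2) => n; rewrite geq_max => /andP[n1 n2].
  rewrite -(fineK (fin _ n1)) lee_fin.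
  have /= := HN2 _ n2; rewrite sub0r normrN; apply: le_trans; exact: ler_norm.
apply/fine_cvgP; split.
  have [N HN] := H 1 ltr01; exists N => // n /= Nn.
  by rewrite ge0_fin_numE// (le_lt_trans (HN _ Nn)) ?ltry.
apply/cvgrPdist_le => e e0; have [N HN] := H e e0; exists N => // n /= Nn.
rewrite sub0r normrN ger0_norm ?fine_ge0// -lee_fin fineK ?HN//.
by rewrite ge0_fin_numE// (le_lt_trans (HN _ Nn)) ?ltry.
Qed.

Lemma cvg_to_0_sqr (v : R^nat) (z M q : R) : 0 < q < 1 ->
  (forall n, (v n - z) ^+ 2 <= M * q ^+ n) -> v @ \oo --> z.
Proof.
move=> /andP[q0 q1] vM.
have cq : M * q ^+ n @[n --> \oo] --> (0 : R).
  by apply: cvg_geometric; rewrite gtr0_norm.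
apply/cvgrPdist_lt => e e0.
have e20 : 0 < e ^+ 2 by rewrite exprn_gt0.
have /cvgrPdist_lt/(_ _ e20)[N _ HN] := cq.
exists N => // n /= Nn; rewrite distrC -(ltr_pXn2r (n := 2)) ?nnegrE ?(ltW e0)//.
rewrite real_normK ?num_real//; apply: (le_lt_trans (vM n)).
by have := HN n Nn; rewrite sub0r normrN; apply: le_lt_trans; exact: ler_norm.
Qed.

End summability.

Section ae_summable.
Context {R : realType} {d} {T : measurableType d} (mu : {measure set T -> \bar R}).

(** The function sum_n h_n / q^n has integral at most C / (1 - q), hence is almost everywhere
    finite, and its value serves as M. The loss from q^2 to q pays for the convergence of the
    series. *)
Lemma ae_geometric_bound (h : nat -> T -> R) (C q : R) : 0 <= C -> 0 < q < 1 ->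
  (forall n, measurable_fun setT (h n)) -> (forall n x, 0 <= h n x) ->
  (forall n, (\int[mu]_x (h n x)%:E <= (C * (q ^+ 2) ^+ n)%:E)%E) ->
  {ae mu, forall x, exists2 M, 0 <= M & forall n, h n x <= M * q ^+ n}.
Proof.
move=> C0 /andP[q0 q1] mh h0 hC.
pose g n x := (h n x / q ^+ n)%:E.
have mg n : measurable_fun setT (g n) by apply/measurable_EFinP/measurable_funM.
have g0 n x : (0 <= g n x)%E by rewrite lee_fin divr_ge0// exprn_ge0// ltW.
have gC : (\int[mu]_x (\sum_(n <oo) g n x) < +oo)%E.
  rewrite integral_nneseries//.
  apply: (@le_lt_trans _ _ (C / (1 - q))%:E); last exact: ltry.
  apply: lime_le; first by apply: is_cvg_nneseries => n _ _; exact: integral_ge0.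
  apply: nearW => n.
  apply: (@le_trans _ _ (\sum_(0 <= k < n) (C * q ^+ k)%:E)%E).
    apply: lee_sum => k _; rewrite /g.
    under eq_integral do rewrite mulrC EFinM.
    rewrite ge0_integralZl//.
    - rewrite lee_pdivrMl ?exprn_gt0// -EFinM.
      by rewrite mulrCA -expr2 -exprM mulnC exprM hC.
    - exact/measurable_EFinP.
    - by move=> x _; rewrite lee_fin.
    - by rewrite lee_fin invr_ge0 exprn_ge0// ltW.
  rewrite sumEFin lee_fin; apply: (geometric_le_lim n C0 q0).
  by rewrite gtr0_norm.
have ig : mu.-integrable setT (fun x => \sum_(n <oo) g n x)%E.
  apply/integrableP; split; first exact: ge0_emeasurable_sum.
  under eq_integral do rewrite gee0_abs ?nneseries_ge0//.
  by [].
apply: filterS (integrable_ae measurableT ig) => x /(_ I) fx.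
exists (fine (\sum_(n <oo) g n x)%E); first by rewrite fine_ge0// nneseries_ge0.
move=> n; rewrite -ler_pdivrMr ?exprn_gt0//.
rewrite -lee_fin fineK//.
have -> : (h n x / q ^+ n)%:E = g n x by [].
rewrite (nneseries_split 0 n.+1)//.
rewrite add0n big_nat_recr//=.
rewrite -addeA addeCA leeDl// adde_ge0 ?sume_ge0// nneseries_ge0//.
Qed.

Lemma fatou_even_moment (V : nat -> T -> R) (Z : T -> R) (m : nat) (c : R) :
  (forall n, measurable_fun setT (V n)) -> measurable_fun setT Z ->
  {ae mu, forall x, V n x @[n --> \oo] --> Z x} ->
  (forall n, (\int[mu]_x (V n x ^+ m.*2)%:E <= c%:E)%E) ->
  (\int[mu]_x (Z x ^+ m.*2)%:E <= c%:E)%E.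
Proof.
move=> mV mZ VZ Vc.
have ev (y : R) : 0 <= y ^+ m.*2 by rewrite exprn_even_ge0// odd_double.
have mVm n : measurable_fun setT (fun x => (V n x ^+ m.*2)%:E).
  by apply/measurable_EFinP; exact: measurable_funX.
apply: (@le_trans _ _ (\int[mu]_x limn_einf (fun n => (V n x ^+ m.*2)%:E))%E).
  rewrite le_eqVlt; apply/orP; left; apply/eqP; apply: ae_eq_integral => //.
  - by apply/measurable_EFinP; exact: measurable_funX.
  - rewrite (_ : (fun x => _) = (fun x => - limn_esup (fun n => - (V n x ^+ m.*2)%:E))%E).
      apply: measurableT_comp => //; apply: measurable_fun_limn_esup => n.
      exact: measurableT_comp.
    by apply/funext => x; rewrite -[in RHS]limn_einfN; congr limn_einf; apply/funext => n /=; rewrite ?oppeK ?opprK.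
  apply: filterS VZ => x Vx _.
  suff /cvg_limn_einf_sup[-> _] : (V n x ^+ m.*2)%:E @[n --> \oo] --> (Z x ^+ m.*2)%:E by [].
  apply: cvg_EFin; first exact: nearW.
  exact: (cvg_comp _ _ Vx (@exprn_continuous R m.*2 (Z x))).
apply: (le_trans (fatou mu measurableT mVm _)).
  by move=> n x _; rewrite lee_fin.
rewrite limn_einf_lim; apply: lime_le; first exact: is_cvg_einfs.
apply: nearW => n; apply: le_trans (Vc n).
by apply: ereal_inf_lbound; exists n => /=.
Qed.

(** The indices are chosen with L^2 errors decaying geometrically, and need not increase. The bound
    N on them allows the use of estimates that hold only from some index on. *)
Lemma sub_cvg_ae (V : nat -> T -> R) (Z : T -> R) :
  (forall n, measurable_fun setT (V n)) -> measurable_fun setT Z ->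
  (\int[mu]_x ((V n x - Z x) ^+ 2)%:E)%E @[n --> \oo] --> 0%E ->
  forall N, exists phi : nat -> nat, (forall k, (N <= phi k)%N) /\
    {ae mu, forall x, V (phi k) x @[k --> \oo] --> Z x}.
Proof.
move=> mV mZ VZ N.
have q0 : 0 < 2^-1 :> R by rewrite invr_gt0.
have q1 : 2^-1 < 1 :> R by rewrite invf_lt1// ltr1n.
have /choice[phi Hphi] k : exists n, (N <= n)%N /\
    (\int[mu]_x ((V n x - Z x) ^+ 2)%:E <= (1 * (2^-1 ^+ 2) ^+ k)%:E)%E.
  have e0 : 0 < 1 * (2^-1 ^+ 2) ^+ k :> R by rewrite mul1r !exprn_gt0.
  have /ge0_cvge0P VZ' := VZ.
  have [|n0 Hn0] := VZ' _ _ e0.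
    by move=> n; apply: integral_ge0 => x _; rewrite lee_fin sqr_ge0.
  by exists (maxn N n0); rewrite leq_maxl; split => //; apply: Hn0; exact: leq_maxr.
exists phi; split; first by move=> k; case: (Hphi k).
have := @ae_geometric_bound (fun k x => (V (phi k) x - Z x) ^+ 2) 1 2^-1 ler01.
rewrite q0 q1 => /(_ isT) H.
apply: filterS (H _ _ _).
- move=> x [M M0 HM].
  by apply: (@cvg_to_0_sqr _ _ _ M 2^-1) => //; rewrite q0 q1.
- by move=> n; apply: measurable_funX; exact: measurable_funB.
- by move=> n x; exact: sqr_ge0.
- by move=> n; case: (Hphi n).
Qed.

End ae_summable.

(** * Density of step functions *)

Lemma L2_cvg_dominated (R : realType) d (T : measurableType d)
    (mu : {measure set T -> \bar R}) (D : set T) (f : T -> R) (g : nat -> T -> R)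
    (k : T -> R) :
  measurable D -> measurable_fun D f -> (forall n, measurable_fun D (g n)) ->
  measurable_fun D k -> (\int[mu]_(x in D) (k x ^+ 2)%:E < +oo)%E ->
  (forall x, D x -> g n x @[n --> \oo] --> f x) ->
  (forall n x, D x -> `|f x - g n x| <= k x) ->
  forall e, 0 < e -> exists n, (\int[mu]_(x in D) ((f x - g n x) ^+ 2)%:E <= e%:E)%E.
Proof.
move=> mD mf mg mk kfin gf fgk e e0.
have mfg n : measurable_fun D (fun x => ((f x - g n x) ^+ 2)%:E).
  by apply/measurable_EFinP; apply: measurable_funX; exact: measurable_funB.
have cvg0 : {ae mu, forall x, D x ->
    ((f x - g n x) ^+ 2)%:E @[n --> \oo] --> cst 0%E x}.
  apply: aeW => x Dx; rewrite (_ : cst 0%E x = ((f x - f x) ^+ 2)%:E); last first.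
    by rewrite subrr expr0n.
  apply: cvg_EFin; first exact: nearW.
  have h : f x - g n x @[n --> \oo] --> f x - f x.
    by apply: cvgB; [exact: cvg_cst|exact: gf].
  exact: (cvg_comp _ _ h (@exprn_continuous R 2 (f x - f x))).
have ik : mu.-integrable D (fun x => (k x ^+ 2)%:E).
  apply/integrableP; split; first by apply/measurable_EFinP; exact: measurable_funX.
  by under eq_integral do rewrite gee0_abs ?lee_fin ?sqr_ge0//.
have fgk2 : {ae mu, forall x, forall n, D x ->
    (`|((f x - g n x) ^+ 2)%:E| <= (k x ^+ 2)%:E)%E}.
  apply: aeW => x n Dx; rewrite gee0_abs ?lee_fin ?sqr_ge0//.
  rewrite -[leLHS]real_normK ?num_real// lerXn2r ?nnegrE//; last exact: fgk.
  by rewrite (le_trans _ (fgk n _ Dx)).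
have [_ _] := dominated_convergence mD mfg (measurable_cst _) cvg0 ik fgk2.
rewrite integral0 => /ge0_cvge0P K.
have [|N HN] := K _ _ e0; last by exists N; apply: HN.
by move=> n; apply: integral_ge0 => x _; rewrite lee_fin sqr_ge0.
Qed.

Section clip.
Context {R : realType}.

Definition clip (M y : R) : R := Num.max (- M) (Num.min M y).

Lemma clip_bound (M y : R) : 0 <= M -> `|clip M y| <= M.
Proof.
move=> M0; rewrite ler_norml /clip /Num.max /Num.min.
by case: (ltP M y) => ?; case: ltP => ?; lra.
Qed.

Lemma clip_id (M y : R) : `|y| <= M -> clip M y = y.
Proof.
rewrite ler_norml => /andP[h1 h2].
by rewrite /clip (min_idPr h2) (max_idPr h1).
Qed.

Lemma clip_lipschitz (M x y : R) : `|x| <= M -> `|x - clip M y| <= `|x - y|.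
Proof.
rewrite ler_norml => /andP[h1 h2]; rewrite /clip /Num.max /Num.min.
have := ler_norm (x - y); have := ler_norm (y - x); rewrite (distrC y x).
move: `|x - y| => r r1 r2; rewrite ler_norml.
by case: (ltP M y) => ?; case: ltP => ?; lra.
Qed.

Lemma clip_dist (M y : R) : 0 <= M -> `|y - clip M y| <= `|y|.
Proof.
move=> M0; have := ler_norm y; have := ler_norm (- y); rewrite normrN.
move: `|y| => r r1 r2; rewrite ler_norml /clip /Num.max /Num.min.
by case: (ltP M y) => ?; case: ltP => ?; lra.
Qed.

Lemma measurable_clip (M : R) : measurable_fun setT (clip M).
Proof.
apply: measurable_maxr => //.
by apply: measurable_minr => //.
Qed.

Lemma continuous_clip (M : R) (g : R -> R) : continuous g -> continuous (clip M \o g).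
Proof.
move=> cg x.
apply: (@continuous_max R _ (cst (- M)) (fun x => Num.min M (g x))); first exact: cvg_cst.
apply: (@continuous_min R _ (cst M) g); [exact: cvg_cst|exact: cg].
Qed.

End clip.

Section uniform_partition.
Context {R : realType}.

Definition unif_partition (t : R) (N : nat) : seq R :=
  mkseq (fun i => t * i.+1%:R / N%:R) N.

Lemma unif_partition_nth (t : R) (N i : nat) : (i <= N)%N ->
  (0 :: unif_partition t N)`_i = t * i%:R / N%:R.
Proof.
case: i => [_|i iN]; first by rewrite /= mulr0 mul0r.
by rewrite /= nth_mkseq.
Qed.

Lemma unif_partitionP (t : R) (N : nat) : 0 < t -> (0 < N)%N ->
  itv_partition 0 t (unif_partition t N).
Proof.
move=> t0 N0; have N0' : 0 < N%:R :> R by rewrite ltr0n.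
split.
  apply/(pathP 0) => i; rewrite size_mkseq => iN.
  rewrite unif_partition_nth ?(ltnW iN)// nth_mkseq//.
  by rewrite ltr_pM2r ?invr_gt0// ltr_pM2l// ltr_nat.
rewrite (last_nth 0) size_mkseq unif_partition_nth//.
by rewrite mulfK// gt_eqF.
Qed.

Lemma exists_cell (z : R) (N : nat) : 0 < z <= N%:R ->
  exists2 k, (k < N)%N & k%:R < z <= k.+1%:R.
Proof.
elim: N => [|N IH] /andP[z0 zN]; first by move: (lt_le_trans z0 zN); rewrite ltxx.
have [zN'|Nz] := leP z N%:R.
  by have [|k kN kz] := IH; [rewrite z0|exists k => //; exact: ltnW].
by exists N => //; rewrite Nz.
Qed.

Lemma step_fun_unif (e : nat -> R) (t s : R) (N : nat) : 0 < s <= t -> (0 < N)%N ->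
  exists2 k, step_fun e (unif_partition t N) s = e k &
    t * k%:R / N%:R < s <= t * k.+1%:R / N%:R.
Proof.
move=> /andP[s0 st] N0; have N0' : 0 < N%:R :> R by rewrite ltr0n.
have t0 := lt_le_trans s0 st.
have [|k kN] := @exists_cell (s * N%:R / t) N.
  by rewrite divr_gt0 ?mulr_gt0//= ler_pdivrMr// mulrC ler_pM2l.
rewrite ltr_pdivlMr// ler_pdivrMr// -![_%:R * t]mulrC -ltr_pdivrMr// -ler_pdivlMr// => ks.
exists k => //.
rewrite /step_fun size_mkseq (bigD1 (Ordinal kN))//= big1 ?addr0.
  rewrite -[X in \1_X](_ : `]t * k%:R / N%:R, t * k.+1%:R / N%:R]%classic = _); last first.
    by rewrite -!unif_partition_nth// ltnW.
  by rewrite indicE mem_setE in_itv/= ks mulr1.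
move=> i ik; rewrite -[X in \1_X](_ : `]t * i%:R / N%:R, t * i.+1%:R / N%:R]%classic = _); last first.
  by rewrite -!unif_partition_nth// ltnW.
rewrite indicE mem_setE in_itv/= (_ : _ && _ = false) ?mulr0//.
apply/negP; move: ks => /andP[k1 k2] /andP[i1 i2].
have h (a b : nat) : t * a%:R / N%:R < t * b%:R / N%:R -> (a < b)%N.
  by rewrite ltr_pM2r ?invr_gt0// ltr_pM2l// ltr_nat.
have := h _ _ (lt_le_trans k1 i2); have := h _ _ (lt_le_trans i1 k2).
move: ik; rewrite -val_eqE/=; lia.
Qed.

Lemma measurable_step_fun (e : nat -> R) x (D : set R) : measurable_fun D (step_fun e x).
Proof.
by apply: measurable_sum => i; apply: measurable_funM.
Qed.

End uniform_partition.

Section density.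
Context {R : realType}.
Local Notation mu := (@lebesgue_measure R).

Lemma lty_integral_cst (t c : R) : (\int[mu]_(s in `]0%R, t]) c%:E < +oo)%E.
Proof.
rewrite integral_cst//= lebesgue_measure_itv/=.
by case: ifP => _; rewrite ?mule0 ?ltry// -EFinB -EFinM ltry.
Qed.

(** Values at left endpoints of uniform cells converge pointwise by continuity, and g and its
    approximations are bounded by M, so dominated convergence applies with majorant 2M. *)
Lemma continuous_step_approx (g : R -> R) (M t : R) : continuous g ->
  (forall x, `|g x| <= M) -> 0 < t -> forall e, 0 < e ->
  exists v x, itv_partition 0 t x /\
    (\int[mu]_(s in `]0%R, t]) ((g s - step_fun v x s) ^+ 2)%:E <= e%:E)%E.
Proof.
move=> cg gM t0 e e0.
pose v n i := g (t * i%:R / n.+1%:R).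
pose x n := unif_partition t n.+1.
suff [n Hn] : exists n,
    (\int[mu]_(s in `]0%R, t]) ((g s - step_fun (v n) (x n) s) ^+ 2)%:E <= e%:E)%E.
  by exists (v n), (x n); split => //; exact: unif_partitionP.
have cell n s : 0 < s <= t -> exists2 p, step_fun (v n) (x n) s = g p &
    `|s - p| <= t / n.+1%:R.
  move=> st; have [k -> /andP[k1 k2]] := step_fun_unif (v n) st (ltn0Sn n).
  exists (t * k%:R / n.+1%:R) => //.
  rewrite ger0_norm ?subr_ge0 ?(ltW k1)// lerBlDl (le_trans k2)//.
  by rewrite -mulrDl -[leRHS]/((t * k%:R + t) / n.+1%:R) -natr1 mulrDr mulr1.
apply: (@L2_cvg_dominated R _ _ mu `]0%R, t]%classic g (fun n => step_fun (v n) (x n)) (cst (M + M))) => //.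
- by apply: measurable_funTS; exact: continuous_measurable_fun.
- by move=> n; exact: measurable_step_fun.
- exact: (lty_integral_cst t ((M + M) ^+ 2)).
- move=> s /=; rewrite in_itv/= => st.
  have /choice[p Hp] n : exists p, step_fun (v n) (x n) s = g p /\
      `|s - p| <= t / n.+1%:R.
    by have [p] := cell n s st; exists p.
  have -> : (fun n => step_fun (v n) (x n) s) = g \o p.
    by apply/funext => n; rewrite (Hp n).1.
  suff ps : p @ \oo --> s by exact: (cvg_comp _ _ ps (cg s)).
  apply/cvgrPdist_le => d d0.
  have /cvgrPdist_le/(_ _ d0)[N _ HN] : t / n.+1%:R @[n --> \oo] --> (0 : R).
    rewrite -[X in _ --> X](mulr0 t); apply: cvgMr; exact: cvg_harmonic.
  exists N => // n /= Nn; apply: (le_trans (Hp n).2).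
  by have := HN n Nn; rewrite sub0r normrN; apply: le_trans; exact: ler_norm.
- move=> n s /=; rewrite in_itv/= => st.
  have [p -> _] := cell n s st.
  by rewrite (le_trans (ler_normB _ _))// lerD.
Qed.

Lemma sqr_addr3 (a b c : R) : (a + b + c) ^+ 2 <= 3 * (a ^+ 2 + b ^+ 2 + c ^+ 2).
Proof.
rewrite -subr_ge0; have -> : 3 * (a ^+ 2 + b ^+ 2 + c ^+ 2) - (a + b + c) ^+ 2 =
  (a - b) ^+ 2 + (b - c) ^+ 2 + (a - c) ^+ 2 by ring.
by rewrite !addr_ge0 ?sqr_ge0.
Qed.

Lemma integral_sqr_addr3 d (T : measurableType d) (nu : {measure set T -> \bar R})
    (D : set T) (f g h : T -> R) (a b c : R) :
  measurable D -> measurable_fun D f -> measurable_fun D g -> measurable_fun D h ->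
  (\int[nu]_(x in D) (f x ^+ 2)%:E <= a%:E)%E ->
  (\int[nu]_(x in D) (g x ^+ 2)%:E <= b%:E)%E ->
  (\int[nu]_(x in D) (h x ^+ 2)%:E <= c%:E)%E ->
  (\int[nu]_(x in D) ((f x + g x + h x) ^+ 2)%:E <= (3 * (a + b + c))%:E)%E.
Proof.
move=> mD mf mg mh fa gb hc.
have m2 (k : T -> R) : measurable_fun D k -> measurable_fun D (fun x => (k x ^+ 2)%:E).
  by move=> mk; apply/measurable_EFinP; exact: measurable_funX.
apply: (@le_trans _ _ (\int[nu]_(x in D)
    (3%:E * ((f x ^+ 2)%:E + (g x ^+ 2)%:E + (h x ^+ 2)%:E)))%E).
  apply: ge0_le_integral => //.
  - by move=> x _; rewrite lee_fin sqr_ge0.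
  - apply: (m2 (fun x => f x + g x + h x)); apply: measurable_funD => //.
    exact: measurable_funD.
  - apply: emeasurable_funM => //; apply: emeasurable_funD; last exact: m2.
    by apply: emeasurable_funD; exact: m2.
  - by move=> x _; rewrite -!EFinD -EFinM lee_fin sqr_addr3.
rewrite ge0_integralZl//; last 2 first.
- by apply: emeasurable_funD; [apply: emeasurable_funD; exact: m2|exact: m2].
- by move=> x _; rewrite -!EFinD lee_fin !addr_ge0// sqr_ge0.
rewrite ge0_integralD//; last 4 first.
- by move=> x _; rewrite -!EFinD lee_fin !addr_ge0// sqr_ge0.
- by apply: emeasurable_funD; exact: m2.
- by move=> x _; rewrite lee_fin sqr_ge0.
- exact: m2.
rewrite ge0_integralD//; last 4 first.
- by move=> x _; rewrite lee_fin sqr_ge0.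
- exact: m2.
- by move=> x _; rewrite lee_fin sqr_ge0.
- exact: m2.
by rewrite EFinM lee_pmul2l ?lte_fin// !EFinD !leeD.
Qed.

(** Continuous functions are dense in L^1; clipping the approximation g to [-M, M] upgrades this to
    L^2, because then |h - clip g|^2 <= 2M |h - g|. *)
Lemma bounded_continuous_approx (h : R -> R) (M t : R) : measurable_fun setT h ->
  (forall x, `|h x| <= M) -> 0 < M -> forall e, 0 < e ->
  exists g, [/\ continuous g, (forall x, `|g x| <= M) &
    (\int[mu]_(s in `]0%R, t]) ((h s - g s) ^+ 2)%:E <= e%:E)%E].
Proof.
move=> mh hM M0 e e0.
have mt : (mu `]0%R, t] < +oo)%E by have := lty_integral_cst t 1; rewrite integral_cst//= mul1e.
have ih : mu.-integrable `]0%R, t] (EFin \o h).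
  apply: measurable_bounded_integrable => //; first exact: measurable_funTS.
  by exists M; split; rewrite ?num_real// => y My x _ /=; rewrite (le_trans (hM x))// ltW.
have [|g [cg ig]] := @approximation_continuous_integrable R _ h _ mt ih.
  by [].
move=> /ge0_cvge0P; have e'0 : 0 < e / (M + M) by rewrite divr_gt0// addr_gt0.
have g0 n : (0 <= \int[mu]_(z in `]0%R, t]) `|(h z - g n z)%:E|)%E by exact: integral_ge0.
move=> /(_ g0 _ e'0)[N /(_ N (leqnn N)) HN].
have mg : measurable_fun `]0%R, t] (g N).
  by apply: measurable_funTS; exact: continuous_measurable_fun.
have mh' : measurable_fun `]0%R, t] h by exact: measurable_funTS.
exists (clip M \o g N); split.
- exact: continuous_clip.
- by move=> x; exact: clip_bound (ltW M0).
apply: (@le_trans _ _ (\int[mu]_(z in `]0%R, t])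
    ((M + M)%:E * `|(h z - g N z)%:E|))%E).
  apply: ge0_le_integral => //.
  - by move=> x _; rewrite lee_fin sqr_ge0.
  - apply/measurable_EFinP; apply: measurable_funX; apply: measurable_funB => //.
    by apply: (measurableT_comp (measurable_clip M)).
  - apply: emeasurable_funM => //; apply: measurableT_comp => //.
    by apply/measurable_EFinP; exact: measurable_funB.
  - move=> x _; rewrite lee_fin -[leLHS]real_normK ?num_real// expr2.
    apply: ler_pM => //; last exact: clip_lipschitz.
    by rewrite (le_trans (ler_normB _ _))// lerD// clip_bound// ltW.
rewrite ge0_integralZl//.
- by rewrite -lee_pdivlMl ?addr_gt0// -EFinM mulrC.
- by apply: measurableT_comp => //; apply/measurable_EFinP; exact: measurable_funB.
- by rewrite lee_fin addr_ge0// ltW.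
Qed.

Lemma step_fun_dense (f : R -> R) (t : R) : measurable_fun setT f -> 0 <= t ->
  (\int[mu]_(s in `]0%R, t]) (f s ^+ 2)%:E < +oo)%E -> forall e, 0 < e ->
  exists v x, itv_partition 0 t x /\
    (\int[mu]_(s in `]0%R, t]) ((f s - step_fun v x s) ^+ 2)%:E <= e%:E)%E.
Proof.
move=> mf; rewrite le_eqVlt => /predU1P[<- _ e e0|t0 ffin e e0].
  exists (fun=> 0), [::]; split; first by split.
  by rewrite set_itvoc0 integral_set0 lee_fin ltW.
(* Truncation, continuous approximation and step approximation each cost e / 9, and the square of a
   sum of three terms costs a factor 3. *)
have e9 : 0 < e / 9 by rewrite divr_gt0.
pose h n x := clip n.+1%:R (f x).
have mh n : measurable_fun setT (h n) by apply: (measurableT_comp (measurable_clip _)).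
have [|||||||n Hn] := @L2_cvg_dominated R _ _ mu `]0%R, t]%classic f h (Num.norm \o f) _ _ _ _ _ _ _ _ e9.
- by [].
- exact: measurable_funTS.
- by move=> n; apply: measurable_funTS; exact: mh.
- by apply: measurableT_comp => //; exact: measurable_funTS.
- by under eq_integral do rewrite /= real_normK ?num_real//.
- move=> x _; apply/cvgrPdist_le => d d0.
  exists (Num.bound `|f x|) => // n /= Nn; rewrite /h clip_id ?subrr ?normr0 ?(ltW d0)//.
  rewrite (le_trans (ltW (archi_boundP (normr_ge0 _))))// ler_nat ltnW//.
- by move=> n x _; exact: clip_dist.
have n1 : 0 < n.+1%:R :> R by [].
have [g [cg gM Hg]] := bounded_continuous_approx t (mh n) (fun x => clip_bound (f x) (ltW n1)) n1 e9.
have [v [x [px Hx]]] := continuous_step_approx cg gM t0 e9.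
exists v, x; split => //.
have mg : measurable_fun `]0%R, t] g.
  by apply: measurable_funTS; exact: continuous_measurable_fun.
have mh' : measurable_fun `]0%R, t] (h n) by exact: measurable_funTS.
have mf' : measurable_fun `]0%R, t] f by exact: measurable_funTS.
have ms := @measurable_step_fun R v x `]0%R, t]%classic.
have H3 := @integral_sqr_addr3 _ _ mu `]0%R, t]%classic (f \- h n) (h n \- g)
  (g \- step_fun v x) _ _ _ (measurable_itv _) (measurable_funB mf' mh')
  (measurable_funB mh' mg) (measurable_funB mg ms) Hn Hg Hx.
rewrite (_ : 3 * (e / 9 + e / 9 + e / 9) = e) in H3; last by lra.
apply: le_trans H3.
rewrite le_eqVlt; apply/orP; left; apply/eqP; apply: eq_integral => s _.
by rewrite /= !addrA !subrK.
Qed.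

End density.

(** * Moments of the Wiener integral *)

Section Lnorm2.
Context {R : realType} {d} {T : measurableType d} (nu : {measure set T -> \bar R}).

Lemma Lnorm2_sqr (f : T -> R) :
  (Lnorm nu 2%:E (EFin \o f) `^ 2 = \int[nu]_x (f x ^+ 2)%:E)%E.
Proof.
rewrite powR_Lnorm//; apply: eq_integral => x _.
by rewrite /= ?poweR_EFin powR_mulrn// real_normK ?num_real.
Qed.

Lemma Lnorm2_le (f : T -> R) (e : R) : 0 <= e ->
  (Lnorm nu 2%:E (EFin \o f) <= e%:E)%E = (\int[nu]_x (f x ^+ 2)%:E <= (e ^+ 2)%:E)%E.
Proof.
move=> e0.
have n2 : (2 : R) != 0 by [].
have nonneg (x : \bar R) : (0 <= x)%E -> (x \in `[0, +oo])%E by move=> x0; rewrite in_itv/= leey andbT.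
rewrite -Lnorm2_sqr; apply/idP/idP => h.
  have := @gt0_ler_poweR R 2 (ler0n _ _) _ _ (nonneg _ (Lnorm_ge0 _ _ _)) (nonneg e%:E _) h.
  by rewrite /= ?poweR_EFin powR_mulrn//; apply; rewrite lee_fin.
have i2 : 0 <= 2^-1 :> R by rewrite invr_ge0.
have := @gt0_ler_poweR R 2^-1 i2 _ _ (nonneg _ (poweR_ge0 _ _)) (nonneg (e ^+ 2)%:E _) h.
rewrite /= -poweRrM mulfV// poweRe1 ?Lnorm_ge0// ?poweR_EFin -powR_mulrn//.
rewrite -powRrM mulfV// powRr1//; apply.
by rewrite lee_fin powR_ge0.
Qed.

Lemma cvg_Lnorm2 (f : nat -> T -> R) :
  Lnorm nu 2%:E (EFin \o f n) @[n --> \oo] --> 0%E <->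
  (\int[nu]_x (f n x ^+ 2)%:E)%E @[n --> \oo] --> 0%E.
Proof.
have i0 n : (0 <= \int[nu]_x (f n x ^+ 2)%:E)%E.
  by apply: integral_ge0 => x _; rewrite lee_fin sqr_ge0.
split => [/ge0_cvge0P|/ge0_cvge0P] H; apply/ge0_cvge0P => //.
- move=> e e0.
  have s0 : 0 < Num.sqrt e by rewrite sqrtr_gt0.
  have [|N HN] := H _ _ s0; first by move=> n; exact: Lnorm_ge0.
  by exists N => n /HN; rewrite (Lnorm2_le _ (ltW s0)) sqr_sqrtr // ltW.
- by move=> n; exact: Lnorm_ge0.
- move=> e e0.
  have s0 : 0 < e ^+ 2 by rewrite exprn_gt0.
  have [|N HN] := H _ _ s0; first by [].
  by exists N => n /HN; rewrite (Lnorm2_le _ (ltW e0)).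
Qed.

End Lnorm2.

Section steps.
Context {R : realType}.
Local Notation mu := (@lebesgue_measure R).

Lemma partition_nth (t : R) (x : seq R) (i : nat) : itv_partition 0 t x ->
  (i < size x)%N -> 0 <= (0 :: x)`_i <= (0 :: x)`_i.+1 /\ (0 :: x)`_i.+1 <= t.
Proof.
move=> px ix.
have h0 : 0 <= (0 :: x)`_i.
  by rewrite (set_nth_default t) /= ?ltnS ?(ltnW ix)// itv_partition_nth_ge// ltnS ltnW.
have h1 : (0 :: x)`_i.+1 <= t.
  by rewrite (set_nth_default t) ?ltnS// itv_partition_nth_le.
have [/(pathP 0)/(_ i ix) h2 _] := px.
by rewrite h0 h1; split => //; exact: ltW.
Qed.

Lemma step_fun_out (t : R) (e : nat -> R) (x : seq R) (s : R) : itv_partition 0 t x ->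
  ~~ (0 < s <= t) -> step_fun e x s = 0.
Proof.
move=> px st; rewrite /step_fun big1// => i _.
rewrite indicE mem_setE in_itv/=.
have [/andP[h0 h1] h2] := partition_nth px (ltn_ord i).
rewrite (_ : _ && _ = false) ?mulr0//; apply/negbTE; apply: contra st => /andP[a b].
by rewrite (le_lt_trans h0 a) (le_trans b h2).
Qed.

(** Each increment is split into two values of W. Step integrals over different partitions can then
    be subtracted by concatenating lists, without a common refinement. *)
Definition step_terms (e : nat -> R) (x : seq R) : seq (R * R) :=
  [seq (e i, (0 :: x)`_i.+1) | i <- index_iota 0 (size x)] ++
  [seq (- e i, (0 :: x)`_i) | i <- index_iota 0 (size x)].

Lemma step_terms_ge0 (t : R) (e : nat -> R) (x : seq R) p : itv_partition 0 t x ->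
  p \in step_terms e x -> 0 <= p.2.
Proof.
move=> px; rewrite mem_cat => /orP[] /mapP[i];
  rewrite mem_index_iota => /= ix -> /=;
  have [/andP[h0 h1] _] := partition_nth px ix => //.
exact: le_trans h1.
Qed.

Lemma sum_step_terms (e : nat -> R) (x : seq R) (F : R -> R) :
  \sum_(p <- step_terms e x) p.1 * F p.2 =
  \sum_(i < size x) e i * (F (0 :: x)`_i.+1 - F (0 :: x)`_i).
Proof.
rewrite big_cat/= !big_map !big_mkord -big_split/=.
by apply: eq_bigr => i _; rewrite mulrBr mulNr.
Qed.

Lemma step_terms_kernel (t : R) (e : nat -> R) (x : seq R) (s : R) :
  itv_partition 0 t x -> wiener_sum_kernel (step_terms e x) s = step_fun e x s.
Proof.
move=> px; rewrite /wiener_sum_kernel.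
rewrite (sum_step_terms e x (fun t => \1_(`]0, t]%classic) s)).
apply: eq_bigr => i _; rewrite indic_itv0_sub//.
by have [] := partition_nth px (ltn_ord i).
Qed.

Lemma step_fun_opp (e : nat -> R) (x : seq R) (s : R) :
  step_fun (fun i => - e i) x s = - step_fun e x s.
Proof. by rewrite /step_fun -sumrN; apply: eq_bigr => i _; rewrite mulNr. Qed.

End steps.

Section wiener_integral.
Context {R : realType} {d : measure_display} {Omega : measurableType d}
  {P : probability Omega R}.
Variable W : R -> {RV P >-> R}.
Hypothesis hW : wiener_process W.
Local Notation mu := (@lebesgue_measure R).

Lemma step_terms_sum (e : nat -> R) (x : seq R) :
  wiener_sum W (step_terms e x) = step_integral W e x.
Proof. by apply/funext => w; rewrite /wiener_sum (sum_step_terms e x (W ^~ w)). Qed.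

Lemma measurable_step_integral (e : nat -> R) (x : seq R) :
  measurable_fun setT (step_integral W e x).
Proof. by rewrite -step_terms_sum; exact: measurable_wiener_sum. Qed.

Lemma step_integral_moment (m : nat) : exists2 C : R, 0 < C &
  forall (t : R) (e : nat -> R) (x : seq R) (t' : R) (e' : nat -> R) (x' : seq R) (v : R),
  itv_partition 0 t x -> itv_partition 0 t' x' -> 0 < v ->
  (\int[mu]_s ((step_fun e x s - step_fun e' x' s) ^+ 2)%:E <= v%:E)%E ->
  (\int[P]_w ((step_integral W e x w - step_integral W e' x' w) ^+ m.*2)%:E
    <= (C * v ^+ m)%:E)%E.
Proof.
have [C C0 HC] := wiener_sum_moment m hW.
exists C => // t e x t' e' x' v px px' v0 hv.
pose l := step_terms e x ++ step_terms (fun i => - e' i) x'.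
have := HC l v; rewrite (_ : wiener_sum W l =
    fun w => step_integral W e x w - step_integral W e' x' w); last first.
  apply/funext => w; rewrite -!step_terms_sum /wiener_sum big_cat/=; congr (_ + _).
  by rewrite !(sum_step_terms _ _ (W ^~ w)) -sumrN; apply: eq_bigr => i _; rewrite mulNr.
rewrite (_ : wiener_sum_kernel l = fun s => step_fun e x s - step_fun e' x' s); last first.
  apply/funext => s; rewrite /wiener_sum_kernel big_cat/= -step_fun_opp.
  by rewrite -(step_terms_kernel _ _ px) -(step_terms_kernel _ _ px').
apply => //.
by move=> p; rewrite mem_cat => /orP[]; [exact: step_terms_ge0 px|exact: step_terms_ge0 px'].
Qed.

(** The convergences of [is_wiener_integral] as integrals of squares over the whole line, so that
    integrals up to different times can be compared. *)
Definition L2_steps (t : R) (f : R -> R) (Y : Omega -> R)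
    (e : nat -> nat -> R) (x : nat -> seq R) :=
  [/\ forall n, itv_partition 0 t (x n),
    (\int[mu]_s (((f \_ `[0, t]) s - step_fun (e n) (x n) s) ^+ 2)%:E)%E @[n --> \oo] --> 0%E &
    (\int[P]_w ((Y w - step_integral W (e n) (x n) w) ^+ 2)%:E)%E @[n --> \oo] --> 0%E].

Lemma patch_step (t : R) (f : R -> R) (e : nat -> R) (x : seq R) : itv_partition 0 t x ->
  (f \- step_fun e x) \_ `[0, t] = (f \_ `[0, t]) \- step_fun e x.
Proof.
move=> px; apply/funext => s; rewrite /patch /=; case: ifPn => // st.
rewrite (step_fun_out e px) ?subr0//; apply: contra st => /andP[s0 st].
by rewrite mem_setE in_itv/= (ltW s0).
Qed.

Lemma is_wiener_integralP (t : R) (f : R -> R) (Y : {RV P >-> R}) :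
  is_wiener_integral W t f Y <->
  Lp_on `[0, t] 2%:E f /\ exists e x, L2_steps t f Y e x.
Proof.
split => -[Lf [e [x [px fx Yx]]]]; split => //; exists e, x; split => //.
- move/cvg_Lnorm2 : fx; under eq_fun do under eq_integral do rewrite patch_step//.
  by [].
- by apply/cvg_Lnorm2.
- apply/cvg_Lnorm2; under eq_fun do under eq_integral do rewrite patch_step//.
  by [].
- by move/cvg_Lnorm2 : Yx.
Qed.

Lemma Lp2_integrable (D : set R) (f : R -> R) : Lp_on D 2%:E f ->
  measurable_fun setT (f \_ D) /\ (\int[mu]_s ((f \_ D) s ^+ 2)%:E < +oo)%E.
Proof.
move=> Lf; split; first by move: Lf; rewrite /Lp_on inE => /andP[]; rewrite inE.
have /integrableP[_] := Lfun2_integrable_sqr Lf.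
by under eq_integral do rewrite /= ger0_norm ?sqr_ge0//.
Qed.

(** The bound v / 4 leaves room for the two step approximations: 3 (v/24 + v/4 + v/24) = v. From
    some N on, the differences of the approximating step integrals thus satisfy the moment bound;
    along indices beyond N they converge almost surely, and Fatou's lemma concludes. *)
Lemma wiener_integral_moment (m : nat) : exists2 C : R, 0 < C &
  forall (t t' : R) (f f' : R -> R) (Y Y' : {RV P >-> R}) (v : R),
  is_wiener_integral W t f Y -> is_wiener_integral W t' f' Y' -> 0 < v ->
  (\int[mu]_s (((f \_ `[0, t]) s - (f' \_ `[0, t']) s) ^+ 2)%:E <= (v / 4)%:E)%E ->
  (\int[P]_w ((Y w - Y' w) ^+ m.*2)%:E <= (C * v ^+ m)%:E)%E.
Proof.
have [C C0 HC] := step_integral_moment m.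
exists C => // t t' f f' Y Y' v.
move=> /is_wiener_integralP[/Lp2_integrable[mf _] [e [x [px fx Yx]]]].
move=> /is_wiener_integralP[/Lp2_integrable[mf' _] [e' [x' [px' fx' Yx']]]] v0 hv.
pose S n := step_integral W (e n) (x n).
pose S' n := step_integral W (e' n) (x' n).
have mS n : measurable_fun setT (S n) by exact: measurable_step_integral.
have mS' n : measurable_fun setT (S' n) by exact: measurable_step_integral.
have ms n := @measurable_step_fun R (e n) (x n) setT.
have ms' n := @measurable_step_fun R (e' n) (x' n) setT.
have v24 : 0 < v / 24 by rewrite divr_gt0.
have i0 (d1 : measure_display) (T1 : measurableType d1) (nu : {measure set T1 -> \bar R})
    (g : T1 -> R) : (0 <= \int[nu]_x (g x ^+ 2)%:E)%E.
  by apply: integral_ge0 => z _; rewrite lee_fin sqr_ge0.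
have [N HN] : exists N, forall n, (N <= n)%N ->
    (\int[P]_w ((S n w - S' n w) ^+ m.*2)%:E <= (C * v ^+ m)%:E)%E.
  have [|N1 HN1] := (ge0_cvge0P _).1 fx _ v24; first by move=> n; exact: i0.
  have [|N2 HN2] := (ge0_cvge0P _).1 fx' _ v24; first by move=> n; exact: i0.
  exists (maxn N1 N2) => n; rewrite geq_max => /andP[n1 n2].
  apply: (HC _ _ _ _ _ _ _ (px n) (px' n)) => //.
  have h1 : (\int[mu]_s ((step_fun (e n) (x n) s - (f \_ `[0, t]) s) ^+ 2)%:E <= (v / 24)%:E)%E.
    by under eq_integral do rewrite -sqrrN opprB; exact: HN1.
  have := @integral_sqr_addr3 R _ _ mu setT (step_fun (e n) (x n) \- f \_ `[0, t])
    (f \_ `[0, t] \- f' \_ `[0, t']) (f' \_ `[0, t'] \- step_fun (e' n) (x' n)) _ _ _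
    measurableT (measurable_funB (ms n) mf) (measurable_funB mf mf')
    (measurable_funB mf' (ms' n)) h1 hv (HN2 n n2).
  have -> : 3 * (v / 24 + v / 4 + v / 24) = v by lra.
  by under eq_integral do rewrite /= !addrA !subrK.
have cD : (\int[P]_w (((S n w - S' n w) - (Y w - Y' w)) ^+ 2)%:E)%E @[n --> \oo] --> 0%E.
  apply/ge0_cvge0P => [n|r r0]; first exact: i0.
  have r6 : 0 < r / 6 by rewrite divr_gt0.
  have [|N1 HN1] := (ge0_cvge0P _).1 Yx _ r6; first by move=> n; exact: i0.
  have [|N2 HN2] := (ge0_cvge0P _).1 Yx' _ r6; first by move=> n; exact: i0.
  exists (maxn N1 N2) => n; rewrite geq_max => /andP[n1 n2].
  have h1 : (\int[P]_w ((S n w - Y w) ^+ 2)%:E <= (r / 6)%:E)%E.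
    by under eq_integral do rewrite -sqrrN opprB; exact: HN1.
  have h0 : (\int[P]_w ((cst 0 w : R) ^+ 2)%:E <= 0%:E)%E.
    by under eq_integral do rewrite /= expr0n; rewrite integral0.
  have := @integral_sqr_addr3 R _ _ P setT (S n \- Y) (Y' \- S' n) (cst 0) _ _ _
    measurableT (measurable_funB (mS n) (measurable_funP Y))
    (measurable_funB (measurable_funP Y') (mS' n)) (measurable_cst _) h1 (HN2 n n2) h0.
  have -> : 3 * (r / 6 + r / 6 + 0) = r by lra.
  apply: le_trans; rewrite le_eqVlt; apply/orP; left; apply/eqP.
  by apply: eq_integral => w _ /=; congr ((_ ^+ 2)%:E); ring.
have [phi [Nphi ae]] := sub_cvg_ae (fun n => measurable_funB (mS n) (mS' n))
  (measurable_funB (measurable_funP Y) (measurable_funP Y')) cD N.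
apply: (fatou_even_moment (V := fun k => S (phi k) \- S' (phi k)) _ _ ae).
- by move=> n; exact: measurable_funB.
- exact: measurable_funB.
- by move=> k; exact: HN.
Qed.

Lemma wiener_integral_unique (t : R) (f : R -> R) (Y Y' : {RV P >-> R}) :
  is_wiener_integral W t f Y -> is_wiener_integral W t f Y' ->
  {ae P, forall w, Y w = Y' w}.
Proof.
move=> fY fY'.
have [C C0 HC] := wiener_integral_moment 1.
have H (r : R) : 0 < r -> (\int[P]_w ((Y w - Y' w) ^+ 2)%:E <= r%:E)%E.
  (* The two kernels coincide, so every v > 0 is admissible; v = r / C gives the bound r. *)
  move=> r0; have rC : 0 < r / C by rewrite divr_gt0.
  have := HC _ _ _ _ _ _ _ fY fY' rC; rewrite expr1 [C * _]mulrC divfK ?gt_eqF//; apply.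
  under eq_integral do rewrite subrr expr0n/=.
  by rewrite integral0 lee_fin !divr_ge0// ltW.
have I0 : (\int[P]_w ((Y w - Y' w) ^+ 2)%:E = 0)%E.
  apply/eqP; rewrite eq_le; apply/andP; split.
    by apply/lee_addgt0Pr => r r0; rewrite add0e; exact: H.
  by apply: integral_ge0 => w _; rewrite lee_fin sqr_ge0.
have m2 : measurable_fun setT (fun w => ((Y w - Y' w) ^+ 2)%:E).
  by apply/measurable_EFinP; apply: measurable_funX; exact: measurable_funB.
have := (ae_eq_integral_abs P measurableT m2).1.
under eq_integral do rewrite gee0_abs ?lee_fin ?sqr_ge0//.
move=> /(_ I0); apply: filterS => w /(_ I) /= [] /eqP.
by rewrite sqrf_eq0 subr_eq0 => /eqP.
Qed.

End wiener_integral.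

(** * Existence of the Wiener integral *)

(** The upper limit is measurable on the whole space and agrees with the limit wherever the latter
    exists. *)
Lemma exists_ae_limit (R : realType) d (T : measurableType d)
    (mu : {measure set T -> \bar R}) (V : nat -> T -> R) :
  (forall n, measurable_fun setT (V n)) ->
  {ae mu, forall x, cvgn (V ^~ x)} ->
  exists Z : {mfun T >-> R}, {ae mu, forall x, V n x @[n --> \oo] --> Z x}.
Proof.
move=> mV cV.
pose Z x := fine (limn_esup (fun n => (V n x)%:E)).
have mZ : measurable_fun setT Z.
  apply: (measurableT_comp (fine_measurable measurableT)).
  by apply: measurable_fun_limn_esup => n; exact/measurable_EFinP.
pose Z' : {mfun T >-> R} := HB.pack Z (isMeasurableFun.Build _ _ _ _ _ mZ).
exists Z'; apply: filterS cV => x cx.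
suff -> : Z' x = limn (V ^~ x) by exact: cx.
rewrite /= /Z.
have /cvg_limn_einf_sup[_ ->//] : (V n x)%:E @[n --> \oo] --> (limn (V ^~ x))%:E.
by apply: cvg_EFin; [exact: nearW|exact: cx].
Qed.

Section existence.
Context {R : realType} {d : measure_display} {Omega : measurableType d}
  {P : probability Omega R}.
Variable W : R -> {RV P >-> R}.
Hypothesis hW : wiener_process W.
Local Notation mu := (@lebesgue_measure R).

Lemma integral_obnd_supp (t : R) (G : R -> \bar R) : measurable_fun setT G ->
  (forall s, s \notin `[0, t] -> G s = 0%E) ->
  (\int[mu]_s G s = \int[mu]_(s in `]0%R, t]) G s)%E.
Proof.
move=> mG G0; rewrite integral_itv_obnd_cbnd; last exact: measurable_funTS.
rewrite [RHS]integral_mkcond; apply: eq_integral => s _.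
by rewrite /patch; case: ifPn => //; rewrite mem_setE => /G0.
Qed.

(** Squared errors of 16^-n make the squared increments of the step integrals almost surely O(4^-n),
    so that these integrals converge almost surely; the limit is then shown to be an L^2 limit
    too. *)
Lemma wiener_integral_exists (t : R) (f : R -> R) : 0 <= t -> Lp_on `[0, t] 2%:E f ->
  exists Y : {RV P >-> R}, is_wiener_integral W t f Y.
Proof.
move=> t0 Lf.
have [mf fin] := Lp2_integrable Lf.
pose f1 := f \_ `[0, t].
pose q : R := 4^-1.
have q0 : 0 < q by rewrite invr_gt0.
have q1 : q < 1 by rewrite invf_lt1// ltr1n.
have fin' : (\int[mu]_(s in `]0%R, t]) (f1 s ^+ 2)%:E < +oo)%E.
  apply: le_lt_trans fin; apply: ge0_subset_integral => //.
  - by apply/measurable_EFinP; exact: measurable_funX.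
  - by move=> s _; rewrite lee_fin sqr_ge0.
have /choice[e /choice[x Hx]] n : exists e x, itv_partition 0 t x /\
    (\int[mu]_s ((f1 s - step_fun e x s) ^+ 2)%:E <= ((q ^+ 2) ^+ n)%:E)%E.
  have [e [x [px Hx]]] := step_fun_dense mf t0 fin' (exprn_gt0 n (exprn_gt0 2 q0)).
  exists e, x; split => //.
  rewrite (integral_obnd_supp (t := t)).
  - exact: Hx.
  - apply/measurable_EFinP; apply: measurable_funX; apply: measurable_funB => //.
    exact: measurable_step_fun.
  - move=> s st; rewrite (step_fun_out e px); last first.
      by apply: contra st => /andP[s0 s1]; rewrite in_itv/= s1 ltW.
    by rewrite /f1 /patch mem_setE (negbTE st) subrr expr0n.
have px n : itv_partition 0 t (x n) by have [] := Hx n.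
pose S n := step_integral W (e n) (x n).
have mS n : measurable_fun setT (S n) by exact: measurable_step_integral.
have ms n := @measurable_step_fun R (e n) (x n) setT.
have [C C0 HC] := step_integral_moment hW 1.
have SS n k : (n <= k)%N ->
    (\int[P]_w ((S k w - S n w) ^+ 2)%:E <= ((C * 6) * (q ^+ 2) ^+ n)%:E)%E.
  move=> nk; rewrite -mulrA -[X in (_ <= (_ * X)%:E)%E]expr1.
  (* 6 = 3 (1 + 1 + 0): the three-term inequality is applied with a third term 0. *)
  have v0 : 0 < 6 * (q ^+ 2) ^+ n by rewrite mulr_gt0// !exprn_gt0.
  apply: (HC _ _ _ _ _ _ _ (px k) (px n) v0).
  have h1 : (\int[mu]_s ((step_fun (e k) (x k) s - f1 s) ^+ 2)%:E <= ((q ^+ 2) ^+ n)%:E)%E.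
    under eq_integral do rewrite -sqrrN opprB; apply: (le_trans (Hx k).2).
    by rewrite lee_fin ler_wiXn2l// ?exprn_ge0// ?exprn_ile1// ltW.
  have h0 : (\int[mu]_w ((cst 0 w : R) ^+ 2)%:E <= 0%:E)%E.
    by under eq_integral do rewrite /= expr0n; rewrite integral0.
  have := @integral_sqr_addr3 R _ _ mu setT (step_fun (e k) (x k) \- f1)
    (f1 \- step_fun (e n) (x n)) (cst 0) _ _ _
    measurableT (measurable_funB (ms k) mf)
    (measurable_funB mf (ms n)) (measurable_cst _) h1 (Hx n).2 h0.
  set a := (q ^+ 2) ^+ n; have -> : 3 * (a + a + 0) = 6 * a by lra.
  apply: le_trans; rewrite le_eqVlt; apply/orP; left; apply/eqP.
  by apply: eq_integral => s _ /=; congr ((_ ^+ 2)%:E); ring.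
have C60 : 0 <= C * 6 by rewrite mulr_ge0// ltW.
have aeS : {ae P, forall w, cvgn (S ^~ w)}.
  have q01 : 0 < q < 1 by rewrite q0.
  apply: filterS (ae_geometric_bound C60 q01 _ _ (fun n => SS n n.+1 (leqnSn n))).
  - move=> w [M M0 HM].
    have h01 : 0 < (2^-1 : R) < 1 by rewrite invr_gt0 ltr0n invf_lt1// ltr1n.
    have [n|l [cl _]] := geometric_cauchy_cvg (u := S ^~ w) (sqrtr_ge0 M) h01.
      rewrite -(@ler_pXn2r _ 2)// ?nnegrE ?mulr_ge0 ?exprn_ge0//.
      rewrite real_normK ?num_real// exprMn sqr_sqrtr// -exprM mulnC exprM.
      have -> : 2^-1 ^+ 2 = q :> R by rewrite /q exprVn -natrX.
      exact: HM.
    by apply/cvg_ex; exists l.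
  - by move=> n; apply: measurable_funX; exact: measurable_funB.
  - by move=> n w; exact: sqr_ge0.
have [Y aeY] := exists_ae_limit mS aeS.
exists Y; apply/is_wiener_integralP; split => //; exists e, x; split => //.
  apply/ge0_cvge0P => [n|r r0].
    by apply: integral_ge0 => s _; rewrite lee_fin sqr_ge0.
  have : (q ^+ 2) ^+ n @[n --> \oo] --> (0 : R).
    by apply: cvg_expr; rewrite gtr0_norm ?exprn_gt0// exprn_ilt1// ltW.
  move=> /cvgrPdist_le/(_ _ r0)[N _ HN]; exists N => n Nn.
  apply: (le_trans (Hx n).2); rewrite lee_fin.
  by have := HN n Nn; rewrite sub0r normrN; apply: le_trans; exact: ler_norm.
apply/ge0_cvge0P => [n|r r0].
  by apply: integral_ge0 => s _; rewrite lee_fin sqr_ge0.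
have : (C * 6) * (q ^+ 2) ^+ n @[n --> \oo] --> (0 : R).
  by apply: cvg_geometric; rewrite gtr0_norm ?exprn_gt0// exprn_ilt1// ltW.
move=> /cvgrPdist_le/(_ _ r0)[N _ HN]; exists N => n Nn.
apply: (@le_trans _ _ ((C * 6) * (q ^+ 2) ^+ n)%:E); last first.
  rewrite lee_fin.
  by have := HN n Nn; rewrite sub0r normrN; apply: le_trans; exact: ler_norm.
(* The bound on S (n + k) - S n is uniform in k, so Fatou's lemma transfers it to Y - S n. *)
apply: (@fatou_even_moment _ _ _ P (fun k => S (n + k)%N \- S n) (Y \- S n) 1).
- by move=> k; exact: measurable_funB.
- exact: measurable_funB.
- apply: filterS aeY => w Yw; apply: cvgB; last exact: cvg_cst.
  have := Yw; rewrite -(cvg_shiftn n (S ^~ w)); apply: cvg_trans.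
  by apply: near_eq_cvg; apply: nearW => k /=; rewrite addnC.
- by move=> k; apply: SS; exact: leq_addr.
Qed.

End existence.

(** * Kolmogorov continuity in a distorted time *)

Section hat.
Context {R : realType}.

(** The tent function: its integer translates form a partition of unity, and sums against them are
    piecewise linear interpolations. *)
Definition hat (x : R) : R := Num.max 0 (1 - `|x|).

Lemma hat_ge0 (x : R) : 0 <= hat x.
Proof. by rewrite le_max lexx. Qed.

Lemma hat_eq0 (x : R) : 1 <= `|x| -> hat x = 0.
Proof. by move=> x1; apply/max_idPl; rewrite subr_le0. Qed.

Lemma continuous_hat : continuous hat.
Proof.
move=> x; apply: (@continuous_max R _ (cst 0) (fun x => 1 - `|x|)); first exact: cvg_cst.
by apply: cvgB; [exact: cvg_cst|exact: norm_continuous].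
Qed.

(** The partial sums also have to be known beyond N, where they descend to 0, for the induction to
    go through. *)
Lemma hat_sum_min (N : nat) (z : R) : 0 <= z ->
  \sum_(k < N.+1) hat (z - k%:R) = Num.min 1 (Num.max 0 (N.+1%:R - z)).
Proof.
move=> z0; elim: N => [|N IH].
  rewrite big_ord_recl big_ord0 addr0 subr0 /hat ger0_norm// /Num.max /Num.min.
  by case: ltP => ?; case: ltP => ?; lra.
rewrite big_ord_recr/= IH /hat -[N.+2%:R]natr1.
move: (N.+1%:R : R) => a; rewrite /Num.max /Num.min.
case: (ger0P (z - a)) => ?; case: (ltP 0 (a - z)) => ?; case: (ltP 0 (a + 1 - z)) => ?;
  case: (ltP 0 (1 - _)) => ?; do ! (case: ltP => ?); lra.
Qed.

Lemma hat_sum (N : nat) (z : R) : 0 <= z <= N%:R ->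
  \sum_(k < N.+1) hat (z - k%:R) = 1.
Proof.
move=> /andP[z0 zN]; rewrite hat_sum_min// -natr1.
move: zN; move: (N%:R : R) => a za; rewrite /Num.max /Num.min.
by case: (ltP 0 (a + 1 - z)) => ?; case: ltP => ?; lra.
Qed.

(** An interpolated value is a convex combination of the values at the nodes less than 1 away. *)
Lemma interpolation_bound (N : nat) (z c B : R) (x : nat -> R) : 0 <= z <= N%:R ->
  (forall k, (k <= N)%N -> `|z - k%:R| < 1 -> `|x k - c| <= B) ->
  `|\sum_(k < N.+1) x k * hat (z - k%:R) - c| <= B.
Proof.
move=> zN xB.
have cE y : y = \sum_(k < N.+1) hat (z - k%:R) * y by rewrite -mulr_suml hat_sum// mul1r.
rewrite [X in _ - X](cE c) -sumrB [leRHS](cE B).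
apply: (le_trans (ler_norm_sum _ _ _)); apply: ler_sum => k _.
rewrite [hat _ * c]mulrC -mulrBl normrM [X in _ * X]ger0_norm ?hat_ge0// mulrC.
have [h|h] := ltP `|z - k%:R| 1; last by rewrite hat_eq0// !mul0r.
by rewrite ler_wpM2l ?hat_ge0// xB// -ltnS.
Qed.

End hat.

Lemma continuous_within_sum (R : realType) (A : set R) (I : Type) (r : seq I)
    (F : I -> R -> R) : (forall i, {within A, continuous (F i)}) ->
  {within A, continuous (fun t => \sum_(i <- r) F i t)}.
Proof.
move=> cF; elim: r => [|i r IH].
  rewrite (_ : (fun t => _) = cst 0); last by apply/funext => t; rewrite big_nil.
  by move=> t; exact: cvg_cst.
rewrite (_ : (fun t => _) = (fun t => F i t + \sum_(j <- r) F j t)); last first.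
  by apply/funext => t; rewrite big_cons.
by move=> t; apply: cvgD; [exact: cF|exact: IH].
Qed.

Section kolmogorov.
Context {R : realType} {d : measure_display} {Omega : measurableType d}
  (P : probability Omega R).
Variables (X : R -> {RV P >-> R}) (T C : R) (g : R -> R) (m : nat).
Hypotheses (T0 : 0 < T) (cg : {within `[0, T], continuous g}).
Hypothesis g01 : forall t, 0 <= t <= T -> 0 <= g t <= 1.
Hypotheses (g0 : g 0 = 0) (gT : g T = 1) (m0 : (0 < m)%N) (C0 : 0 <= C).
Hypothesis EX : forall s t, 0 <= s <= T -> 0 <= t <= T ->
  (\int[P]_w ((X t w - X s w) ^+ m.*2)%:E <= (C * (g t - g s) ^+ 4)%:E)%E.

Lemma exists_time (u : R) : 0 <= u <= 1 -> exists2 t, 0 <= t <= T & g t = u.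
Proof.
move=> u01; have [|t] := IVT (ltW T0) cg (v := u).
  by rewrite g0 gT (min_idPl _) ?(max_idPr _).
by rewrite in_itv/= => tT; exists t.
Qed.

Lemma ev_ge0 (x : R) : 0 <= x ^+ m.*2.
Proof. by rewrite exprn_even_ge0// odd_double. Qed.

Section grid.
Variable tau : R -> R.
Hypothesis tauP : forall u, 0 <= u <= 1 -> 0 <= tau u <= T /\ g (tau u) = u.

(** Since [tau] is a right inverse of g on [0, 1], these times are equidistant when measured by
    g. *)
Definition grid (n k : nat) : R := tau (k%:R / (2 ^ n)%:R).

Definition interpolant (n : nat) (t : R) (w : Omega) : R :=
  \sum_(k < (2 ^ n).+1) X (grid n k) w * hat ((2 ^ n)%:R * g t - k%:R).

(** The pairs are those nodes of levels n + 1 and n at which g differs by at most 2^-n. The sum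
    dominates each of its terms, hence their maximum. *)
Definition mesh_moment (n : nat) (w : Omega) : R :=
  \sum_(j < (2 ^ n.+1).+1) \sum_(k < (2 ^ n).+1 | (`|j%:R - 2 * k%:R| <= 2 :> R)%R)
    (X (grid n.+1 j) w - X (grid n k) w) ^+ m.*2.

Definition point_moment (t : R) (n : nat) (w : Omega) : R :=
  \sum_(k < (2 ^ n).+1 | (`|(2 ^ n)%:R * g t - k%:R| < 1)%R)
    (X (grid n k) w - X t w) ^+ m.*2.

Lemma pow2_gt0 n : 0 < (2 ^ n)%:R :> R.
Proof. by rewrite ltr0n expn_gt0. Qed.

Lemma gridP n k : (k <= 2 ^ n)%N ->
  0 <= grid n k <= T /\ g (grid n k) = k%:R / (2 ^ n)%:R.
Proof.
move=> kn; apply: tauP; rewrite divr_ge0//= ler_pdivrMr ?pow2_gt0// mul1r.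
by rewrite ler_nat.
Qed.

Lemma integral_diff_grid (s t : R) (n : nat) : 0 <= s <= T -> 0 <= t <= T ->
  `|g t - g s| <= (2 ^ n)%:R^-1 ->
  (\int[P]_w ((X t w - X s w) ^+ m.*2)%:E <= (C * (16^-1) ^+ n)%:E)%E.
Proof.
move=> sT tT gts; apply: (le_trans (EX sT tT)); rewrite lee_fin ler_wpM2l//.
have -> : (g t - g s) ^+ 4 = `|g t - g s| ^+ 4 by rewrite -normrX ger0_norm// exprn_even_ge0.
apply: (@le_trans _ _ ((2 ^ n)%:R^-1 ^+ 4)).
  by rewrite lerXn2r ?nnegrE// invr_ge0.
by rewrite exprVn exprVn -natrX -natrX -!expnM mulnC expnM.
Qed.

Lemma pow_quarter n :
  (2^-1 ^+ 2) ^+ n = 16^-1 ^+ n * ((2 ^ n)%:R * (2 ^ n)%:R) :> R.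
Proof. by rewrite natrX -!exprMn; congr (_ ^+ n); field. Qed.

Lemma measurable_diff s t : measurable_fun setT (fun w => (X t w - X s w) ^+ m.*2).
Proof. by apply: measurable_funX; exact: measurable_funB. Qed.

(* The number of terms is O(4^n), and each expectation is O(16^-n): this is why
   the increment of g enters EX with the fourth power. *)
Lemma integral_mesh_moment n :
  (\int[P]_w (mesh_moment n w)%:E <= ((6 * C) * ((2^-1) ^+ 2) ^+ n)%:E)%E.
Proof.
rewrite /mesh_moment.
under eq_integral do rewrite -sumEFin; rewrite ge0_integral_sum//; last 2 first.
- move=> j; apply/measurable_EFinP.
  under eq_fun do rewrite -big_filter.
  by apply: measurable_sum => k; exact: measurable_diff.
- by move=> j w _; rewrite lee_fin sumr_ge0// => k _; exact: ev_ge0.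
apply: (@le_trans _ _ (\sum_(j < (2 ^ n.+1).+1) (\sum_(k < (2 ^ n).+1) C * 16^-1 ^+ n)%:E)%E).
  apply: lee_sum => j _.
  under eq_integral do rewrite -sumEFin -big_filter; rewrite ge0_integral_sum//; last 2 first.
  - by move=> k; apply/measurable_EFinP; exact: measurable_diff.
  - by move=> k w _; rewrite lee_fin ev_ge0.
  rewrite big_filter -sumEFin [leLHS]big_mkcond/=; apply: lee_sum => k _.
  case: ifPn => [jk|_]; last by rewrite lee_fin mulr_ge0// exprn_ge0// invr_ge0.
  have jn : (j <= 2 ^ n.+1)%N by rewrite -ltnS.
  have kn : (k <= 2 ^ n)%N by rewrite -ltnS.
  have [tj gj] := gridP jn; have [tk gk] := gridP kn.
  apply: integral_diff_grid => //; rewrite gj gk.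
  have p0 := pow2_gt0 n.
  have -> : j%:R / (2 ^ n.+1)%:R - k%:R / (2 ^ n)%:R = (j%:R - 2 * k%:R) / (2 * (2 ^ n)%:R) :> R.
    have -> : (2 ^ n.+1)%:R = 2 * (2 ^ n)%:R :> R by rewrite expnS natrM.
    by field; rewrite gt_eqF.
  rewrite normrM [X in _ * X]ger0_norm ?invr_ge0 ?mulr_ge0//.
  by rewrite ler_pdivrMr ?mulr_gt0// mulrCA mulVf ?gt_eqF// mulr1.
rewrite sumEFin lee_fin !sumr_const !card_ord -[leLHS]mulr_natr -[X in X * _ <= _]mulr_natr.
have p1 : 1 <= (2 ^ n)%:R :> R by rewrite ler1n expn_gt0.
rewrite pow_quarter.
have e0 : 0 <= 16^-1 ^+ n :> R by rewrite exprn_ge0// invr_ge0.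
have -> : C * 16^-1 ^+ n * (2 ^ n).+1%:R * (2 ^ n.+1).+1%:R =
   (C * 16^-1 ^+ n) * ((2 ^ n).+1%:R * (2 ^ n.+1).+1%:R) by ring.
have -> : 6 * C * (16^-1 ^+ n * ((2 ^ n)%:R * (2 ^ n)%:R)) =
   (C * 16^-1 ^+ n) * (6 * ((2 ^ n)%:R * (2 ^ n)%:R)) by ring.
apply: ler_wpM2l; first exact: mulr_ge0.
(* With p = 2^n >= 1, the number of pairs is at most (p + 1)(2p + 1) <= 2p * 3p. *)
rewrite expnS -!natr1 natrM; move: p1; move: (2 ^ n)%:R => p p1; nra.
Qed.

Lemma integral_point_moment t n : 0 <= t <= T ->
  (\int[P]_w (point_moment t n w)%:E <= ((2 * C) * ((2^-1) ^+ 2) ^+ n)%:E)%E.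
Proof.
move=> tT; rewrite /point_moment.
under eq_integral do rewrite -sumEFin -big_filter; rewrite ge0_integral_sum//; last 2 first.
- by move=> k; apply/measurable_EFinP; exact: measurable_diff.
- by move=> k w _; rewrite lee_fin ev_ge0.
rewrite big_filter [leLHS]big_mkcond/=.
apply: (@le_trans _ _ (\sum_(k < (2 ^ n).+1) (C * 16^-1 ^+ n)%:E)%E).
  apply: lee_sum => k _.
  case: ifPn => [jk|_]; last by rewrite lee_fin mulr_ge0// exprn_ge0// invr_ge0.
  have kn : (k <= 2 ^ n)%N by rewrite -ltnS.
  have [tk gk] := gridP kn.
  apply: integral_diff_grid => //; rewrite gk.
  have p0 := pow2_gt0 n.
  have -> : k%:R / (2 ^ n)%:R - g t = (k%:R - (2 ^ n)%:R * g t) / (2 ^ n)%:R :> R.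
    by field; rewrite gt_eqF.
  rewrite normrM [X in _ * X]ger0_norm ?invr_ge0//.
  by rewrite ler_pdivrMr// mulVf ?gt_eqF// distrC ltW.
rewrite sumEFin lee_fin sumr_const card_ord -[leLHS]mulr_natr.
have p1 : 1 <= (2 ^ n)%:R :> R by rewrite ler1n expn_gt0.
rewrite pow_quarter.
have e0 : 0 <= 16^-1 ^+ n :> R by rewrite exprn_ge0// invr_ge0.
have -> : 2 * C * (16^-1 ^+ n * ((2 ^ n)%:R * (2 ^ n)%:R)) =
   (C * 16^-1 ^+ n) * (2 * ((2 ^ n)%:R * (2 ^ n)%:R)) by ring.
apply: ler_wpM2l; first exact: mulr_ge0.
rewrite -!natr1; move: p1; move: (2 ^ n)%:R => p p1; nra.
Qed.

Lemma pow_le_bound (x B : R) : 0 <= B -> x ^+ m.*2 <= B ^+ m.*2 -> `|x| <= B.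
Proof.
move=> B0; have -> : x ^+ m.*2 = `|x| ^+ m.*2 by rewrite -normrX ger0_norm// ev_ge0.
by rewrite ler_pXn2r ?nnegrE// double_gt0.
Qed.

Lemma g_scale t n : 0 <= t <= T -> 0 <= (2 ^ n)%:R * g t <= (2 ^ n)%:R.
Proof.
move=> /g01/andP[a b]; rewrite mulr_ge0//= -[leRHS]mulr1 ler_wpM2l//.
Qed.

(** Both interpolants are averages over nodes near t, so it suffices to compare X at a node of level
    n + 1 with X at a node of level n. *)
Lemma interpolant_step (n : nat) (w : Omega) (B t : R) : 0 <= t <= T -> 0 <= B ->
  mesh_moment n w <= B ^+ m.*2 ->
  `|interpolant n.+1 t w - interpolant n t w| <= B.
Proof.
move=> tT B0 DB.
apply: (@interpolation_bound _ _ _ _ _ (fun j => X (grid n.+1 j) w)); first exact: g_scale.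
move=> j jn hj; rewrite distrC.
apply: (@interpolation_bound _ _ _ _ _ (fun k => X (grid n k) w)); first exact: g_scale.
move=> k kn hk; rewrite distrC; apply: pow_le_bound => //.
apply: le_trans DB; rewrite /mesh_moment.
have jn' : (j < (2 ^ n.+1).+1)%N by [].
have kn' : (k < (2 ^ n).+1)%N by [].
rewrite (bigD1 (Ordinal jn'))//= (bigD1 (Ordinal kn'))/=.
  rewrite -addrA lerDl addr_ge0// sumr_ge0// => i _; first exact: ev_ge0.
  by rewrite sumr_ge0// => k' _; exact: ev_ge0.
(* Node j is less than 1 away from 2^(n+1) g(t), and 2k less than 2. As j - 2k is an integer, it is
   at most 2 in absolute value, which is the range in [mesh_moment]. *)
have h : `|j%:R - 2 * k%:R| < 3 :> R.
  move: hj hk; rewrite expnS natrM; move: (2 ^ n)%:R (g t) => p q.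
  rewrite !ltr_norml; move=> /andP[h1 h2] /andP[h3 h4]; apply/andP; split; lra.
move: h; rewrite -natrM -[j%:R]/(j%:Z%:~R) -[(2 * k)%:R]/((2 * k)%:Z%:~R) -intrB -intr_norm.
rewrite -[3]/(3%:Z%:~R) ltr_int -[X in _ -> (_ <= X)%R]/(2%:Z%:~R) ler_int.
by move=> h; lia.
Qed.

Lemma interpolant_point (n : nat) (w : Omega) (B t : R) : 0 <= t <= T -> 0 <= B ->
  point_moment t n w <= B ^+ m.*2 -> `|interpolant n t w - X t w| <= B.
Proof.
move=> tT B0 DB.
apply: (@interpolation_bound _ _ _ _ _ (fun j => X (grid n j) w)); first exact: g_scale.
move=> k kn hk; apply: pow_le_bound => //.
apply: le_trans DB; rewrite /point_moment.
have kn' : (k < (2 ^ n).+1)%N by [].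
rewrite (bigD1 (Ordinal kn'))//= lerDl sumr_ge0// => i _; exact: ev_ge0.
Qed.

Lemma continuous_interpolant n w : {within `[0, T], continuous (interpolant n ^~ w)}.
Proof.
apply: continuous_within_sum => k t; apply: cvgMr.
have h : {within `[0, T], continuous (fun t => (2 ^ n)%:R * g t - k%:R)}.
  by move=> s; apply: cvgB; [apply: cvgMr; exact: cg|exact: cvg_cst].
apply: cvg_comp; [exact: (h t)|]. exact: continuous_hat.
Qed.

Lemma measurable_interpolant n t : measurable_fun setT (interpolant n t).
Proof. by apply: measurable_sum => k; apply: measurable_funM. Qed.

End grid.

Lemma root_pow (x : R) : 0 <= x -> (x `^ (m.*2%:R)^-1) ^+ m.*2 = x.
Proof.
move=> x0; rewrite -powR_mulrn ?powR_ge0// -powRrM mulVf ?powRr1//.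
by rewrite pnatr_eq0 double_eq0 -lt0n.
Qed.

Theorem kolmogorov_continuity : exists Y : R -> {RV P >-> R},
  modification_on `[0, T] X Y /\
  forall w, {within `[0, T], continuous (fun t : R => Y t w)}.
Proof.
have /choice[tau tauP] u : exists t, 0 <= u <= 1 -> 0 <= t <= T /\ g t = u.
  have [/exists_time[t tT gt]|u01] := boolP (0 <= u <= 1); first by exists t.
  by exists 0.
pose q : R := 2^-1.
have q0 : 0 < q by rewrite invr_gt0.
have q1 : q < 1 by rewrite invf_lt1// ltr1n.
have q01 : 0 < q < 1 by rewrite q0.
(* Moments of order 2m that decay like q^n bound the differences themselves by multiples of
   rho^n. *)
pose rho := q `^ (m.*2%:R)^-1.
have rhoq : rho ^+ m.*2 = q by rewrite root_pow// ltW.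
have rho0 : 0 < rho by exact: powR_gt0.
have rho1 : rho < 1.
  by rewrite ltNge; apply/negP => /(exprn_ege1 m.*2); rewrite rhoq leNgt q1.
have rho01 : 0 < rho < 1 by rewrite rho0.
have C6 : 0 <= 6 * C by rewrite mulr_ge0.
have C2 : 0 <= 2 * C by rewrite mulr_ge0.
have powE K n : 0 <= K -> K * q ^+ n = (K `^ (m.*2%:R)^-1 * rho ^+ n) ^+ m.*2.
  by move=> K0; rewrite exprMn root_pow// -exprM mulnC exprM rhoq.
have mmesh n : measurable_fun setT (mesh_moment tau n).
  apply: measurable_sum => j; rewrite /=.
  under eq_fun do rewrite -big_filter.
  by apply: measurable_sum => k; exact: measurable_diff.
have mesh0 n w : 0 <= mesh_moment tau n w.
  by apply: sumr_ge0 => j _; apply: sumr_ge0 => k _; exact: ev_ge0.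
(* The mesh moments do not involve t, so a single null set N serves all t. Off N the interpolants
   converge uniformly on [0, T]. *)
have [N [mN PN0 subN]] := ae_geometric_bound C6 q01 mmesh mesh0 (integral_mesh_moment tauP).
have goodN w : ~ N w -> exists2 M, 0 <= M & forall n, mesh_moment tau n w <= M * q ^+ n.
  by move=> Nw; apply: contrapT => h; apply: Nw; exact: subN.
(* Putting 0 on N makes every path of the limit continuous, not only almost every one. *)
pose V n t w := \1_(~` N) w * interpolant tau n t w.
have mV n t : measurable_fun setT (V n t).
  apply: measurable_funM; last exact: measurable_interpolant.
  by apply: measurable_indic; exact: measurableC.
have /choice[K HK] w : exists K, 0 <= K /\ forall t, 0 <= t <= T -> forall n,
    `|V n.+1 t w - V n t w| <= K * rho ^+ n.
  have [Nw|Nw] := pselect (N w).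
    exists 0; split => // t tT n.
    by rewrite /V indicE memNset ?mul0r ?subrr ?normr0//=; exact.
  have [M M0 HM] := goodN _ Nw.
  exists (M `^ (m.*2%:R)^-1); split; first exact: powR_ge0.
  move=> t tT n; rewrite /V indicE mem_set// !mul1r.
  apply: interpolant_step => //; first by rewrite mulr_ge0 ?powR_ge0// exprn_ge0// ltW.
  by rewrite -powE.
have limV w t : 0 <= t <= T -> V n t w @[n --> \oo] --> limn (fun n => V n t w) /\
    forall n, `|V n t w - limn (fun n => V n t w)| <= K w * rho ^+ n / (1 - rho).
  move=> tT; have [K0 Kw] := HK w.
  have [l [cl Hl]] := geometric_cauchy_cvg K0 rho01 (Kw t tT).
  by rewrite (cvg_lim _ cl).
(* Convergence is known for t in [0, T] only; the value 0 elsewhere keeps [Z t] measurable for all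
   t. *)
pose Z t w := if 0 <= t <= T then limn (fun n => V n t w) else 0.
have mZ t : measurable_fun setT (Z t).
  have [tT|tT] := boolP (0 <= t <= T).
    apply: (measurable_fun_cvg (mV ^~ t)) => w _.
    by rewrite /Z tT; exact: (limV w t tT).1.
  rewrite (_ : Z t = cst 0); first exact: measurable_cst.
  by apply/funext => w; rewrite /Z (negbTE tT).
pose Y t : {RV P >-> R} := HB.pack (Z t) (isMeasurableFun.Build _ _ _ _ _ (mZ t)).
have cvg_rho L : L * rho ^+ n / (1 - rho) @[n --> \oo] --> (0 : R).
  rewrite -[X in _ --> X](mul0r (1 - rho)^-1); apply: cvgMl.
  by apply: cvg_geometric; rewrite gtr0_norm.
exists Y; split.
  move=> t /=; rewrite in_itv/= => tT.
  have aeN : {ae P, forall w, ~ N w}.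
    by exists N; split => // w; rewrite /= notK.
  have mpt n : measurable_fun setT (point_moment tau t n).
    rewrite /point_moment; under eq_fun do rewrite -big_filter.
    by apply: measurable_sum => k; exact: measurable_diff.
  have pt0 n w : 0 <= point_moment tau t n w.
    by apply: sumr_ge0 => k _; exact: ev_ge0.
  (* For a modification the null set may depend on t. At a fixed t the nodes carrying the
     interpolant approach t as measured by g, so the interpolants also converge to X t. *)
  have := ae_geometric_bound C2 q01 mpt pt0 (fun n => integral_point_moment tauP n tT).
  apply: filterS2 aeN => w Nw [M M0 HM].
  have cX : interpolant tau n t w @[n --> \oo] --> X t w.
    apply/cvgrPdist_le => e e0.
    have : M `^ (m.*2%:R)^-1 * rho ^+ n @[n --> \oo] --> (0 : R).
      by apply: cvg_geometric; rewrite gtr0_norm.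
    move=> /cvgrPdist_le/(_ _ e0)[n0 _ Hn0]; exists n0 => // n /= n0n.
    rewrite distrC; apply: (@le_trans _ _ (M `^ (m.*2%:R)^-1 * rho ^+ n)).
      apply: interpolant_point => //; first by rewrite mulr_ge0 ?powR_ge0// exprn_ge0// ltW.
      by rewrite -powE.
    by have := Hn0 n n0n; rewrite sub0r normrN; apply: le_trans; exact: ler_norm.
  have cY : interpolant tau n t w @[n --> \oo] --> Y t w.
    rewrite /= /Z tT; apply: cvg_trans (limV w t tT).1.
    apply: near_eq_cvg; apply: nearW => n.
    by rewrite /V indicE mem_set// mul1r.
  exact: (cvg_unique _ cX cY).
move=> w; apply/subspace_continuousP => x xA.
apply/cvgrPdist_lt => e e0.
have e3 : 0 < e / 3 by rewrite divr_gt0.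
have /cvgrPdist_lt/(_ _ e3)[n _ /(_ n (leqnn n))] := cvg_rho (K w).
rewrite /= sub0r normrN => /(le_lt_trans (ler_norm _)) Hn.
have xT : 0 <= x <= T by move: xA; rewrite /= in_itv.
have cV : {within `[0, T], continuous (V n ^~ w)}.
  by move=> t; apply: cvgMr; exact: continuous_interpolant.
have /cvgrPdist_lt/(_ _ e3) := (subspace_continuousP _ _).1 cV x xA.
have inA : \forall t \near within `[0, T] (nbhs x), `[0, T]%classic t.
  exact: withinT.
apply: filterS2 inA => t /= tA.
have tT : 0 <= t <= T by move: tA; rewrite in_itv.
move=> Vt; have {}Vt : `|V n x w - V n t w| < e / 3 := Vt.
rewrite -[from_subspace _ _ x]/(Z x w) -[from_subspace _ _ t]/(Z t w) /Z xT tT.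
have hx := le_lt_trans ((limV w x xT).2 n) Hn.
have ht := le_lt_trans ((limV w t tT).2 n) Hn.
move: hx ht Vt; set a := limn _; set b := limn _.
move: (V n x w) (V n t w) => u v; rewrite !ltr_norml.
by move=> /andP[? ?] /andP[? ?] /andP[? ?]; apply/andP; split; lra.
Qed.

End kolmogorov.

(** * A trilinear Young inequality *)

Section translation.
Context {R : realType}.
Local Notation mu := (@lebesgue_measure R).

Lemma measurable_shift (s : R) : measurable_fun setT (fun u : R => u - s).
Proof. by apply: measurable_funB. Qed.

Lemma measurable_reflect (s : R) : measurable_fun setT (fun u : R => s - u).
Proof. by apply: measurable_funB. Qed.

Lemma lebesgue_measure_shift (s : R) (A : set R) : measurable A ->
  pushforward mu (fun u : measurableTypeR R => (u - s : measurableTypeR R)) A = mu A.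
Proof.
move=> mA; apply/esym/lebesgue_measure_unique => //=; first exact: measurable_shift.
move=> _ _ [[a b]] _ <-; rewrite /pushforward.
rewrite (_ : _ @^-1` _ = `]a + s, b + s]%classic).
  rewrite /= !lebesgue_measure_itv/= !lte_fin ltrD2r.
  by case: ifP => // _; rewrite -!EFinB; congr EFin; ring.
by apply/seteqP; split => u /=; rewrite !in_itv/= ltrBrDr lerBlDr.
Qed.

Lemma lebesgue_measure_reflect (s : R) (A : set R) : measurable A ->
  pushforward mu (fun u : measurableTypeR R => (s - u : measurableTypeR R)) A = mu A.
Proof.
move=> mA; apply/esym/lebesgue_measure_unique => //=; first exact: measurable_reflect.
move=> _ _ [[a b]] _ <-; rewrite /pushforward.
rewrite (_ : _ @^-1` _ = `[s - b, s - a[%classic).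
  rewrite /= !lebesgue_measure_itv/= !lte_fin ltrD2l ltrN2.
  by case: ifP => // _; rewrite -!EFinB; congr EFin; ring.
apply/seteqP; split => u /=; rewrite !in_itv/= => /andP[h1 h2]; apply/andP; split; lra.
Qed.

Lemma ge0_integral_shift (s : R) (f : R -> \bar R) : measurable_fun setT f ->
  (forall u, 0 <= f u)%E -> (\int[mu]_u f (u - s)%R = \int[mu]_u f u)%E.
Proof.
move=> mf f0; transitivity (\int[pushforward mu (fun u : measurableTypeR R =>
    ((u - s)%R : measurableTypeR R))]_u f u)%E; last first.
  apply: eq_measure_integral => [|mf' A mA _]; first exact: measurable_shift.
  exact: lebesgue_measure_shift.
rewrite ge0_integral_pushforward//; exact: measurable_shift.
Qed.

Lemma ge0_integral_reflect (s : R) (f : R -> \bar R) : measurable_fun setT f ->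
  (forall u, 0 <= f u)%E -> (\int[mu]_u f (s - u)%R = \int[mu]_u f u)%E.
Proof.
move=> mf f0; transitivity (\int[pushforward mu (fun u : measurableTypeR R =>
    ((s - u)%R : measurableTypeR R))]_u f u)%E; last first.
  apply: eq_measure_integral => [|mf' A mA _]; first exact: measurable_reflect.
  exact: lebesgue_measure_reflect.
rewrite ge0_integral_pushforward//; exact: measurable_reflect.
Qed.

Lemma ae_shift (s : R) (Q : R -> Prop) : {ae mu, forall u, Q u} -> {ae mu, forall u, Q (u - s)}.
Proof.
move=> [N [mN N0 sN]]; exists [set u | N (u - s)]; split.
- by rewrite -[X in measurable X]setTI; exact: measurable_shift.
- by have := lebesgue_measure_shift s mN; rewrite N0.
- by move=> u /= Qu; exact: sN.
Qed.

End translation.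

Lemma cauchy_schwarz (R : realType) d (T : measurableType d)
    (mu : {measure set T -> \bar R}) (f g : T -> R) :
  measurable_fun setT f -> measurable_fun setT g ->
  (forall x, 0 <= f x) -> (forall x, 0 <= g x) ->
  ((\int[mu]_x (f x * g x)%:E) * (\int[mu]_x (f x * g x)%:E) <=
   (\int[mu]_x (f x ^+ 2)%:E) * (\int[mu]_x (g x ^+ 2)%:E))%E.
Proof.
move=> mf mg f0 g0.
have n2 : 2^-1 + 2^-1 = 1 :> R by field.
have := hoelder mu mf mg (ltr0n _ 2) (ltr0n _ 2) n2.
rewrite Lnorm1.
rewrite (_ : (\int[mu]_x `|(EFin \o (f \* g)%R) x| = \int[mu]_x (f x * g x)%:E)%E); last first.
  by apply: eq_integral => x _; rewrite /= ger0_norm ?mulr_ge0.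
have sq (x : \bar R) : (0 <= x)%E -> (x `^ 2 = x * x)%E.
  case: x => [r||]//; last by rewrite poweRyr// mulyy.
  by rewrite lee_fin => r0; rewrite poweR_EFin powR_mulrn.
move=> h; rewrite -!Lnorm2_sqr !sq ?Lnorm_ge0// muleACA.
apply: lee_pmul => //; apply: integral_ge0 => x _; rewrite lee_fin mulr_ge0//.
Qed.

Section young.
Context {R : realType}.
Local Notation mu := (@lebesgue_measure R).
Implicit Types x y z b g d : R.

(** Weighted arithmetic-geometric mean inequality in logarithmic form, with a rough constant: the
    mean is at most the largest exponent. *)
Lemma expR_mean3 (p q r X Y Z : R) : 0 <= X -> 0 <= Y -> 0 <= Z -> X + Y + Z = 1 ->
  expR (X * p + Y * q + Z * r) <= expR p + expR q + expR r.
Proof.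
move=> X0 Y0 Z0 XYZ.
have [p0 q0 r0] : [/\ 0 < expR p, 0 < expR q & 0 < expR r] by split; exact: expR_gt0.
have h v : p <= v -> q <= v -> r <= v -> X * p + Y * q + Z * r <= v.
  move=> pv qv rv; have -> : v = X * v + Y * v + Z * v by rewrite -!mulrDl XYZ mul1r.
  by rewrite !lerD// ler_wpM2l.
have [pq|/ltW qp] := leP p q; have [qr|/ltW rq] := leP q r.
- by rewrite (le_trans (_ : _ <= expR r)) ?ler_expR ?h ?(le_trans pq)//; lra.
- by rewrite (le_trans (_ : _ <= expR q)) ?ler_expR ?h//; lra.
- have [pr|/ltW rp] := leP p r.
    by rewrite (le_trans (_ : _ <= expR r)) ?ler_expR ?h//; lra.
  by rewrite (le_trans (_ : _ <= expR p)) ?ler_expR ?h//; lra.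
- by rewrite (le_trans (_ : _ <= expR p)) ?ler_expR ?h ?(le_trans rq)//; lra.
Qed.

Lemma expR_mean2 (p q X Y : R) : 0 <= X -> 0 <= Y -> X + Y = 1 ->
  expR (X * p + Y * q) <= expR p + expR q.
Proof.
move=> X0 Y0 XY.
have [p0 q0] : 0 < expR p /\ 0 < expR q by split; exact: expR_gt0.
have h v : p <= v -> q <= v -> X * p + Y * q <= v.
  move=> pv qv; have -> : v = X * v + Y * v by rewrite -!mulrDl XY mul1r.
  by rewrite !lerD// ler_wpM2l.
have [pq|/ltW qp] := leP p q.
- by rewrite (le_trans (_ : _ <= expR q)) ?ler_expR ?h//; lra.
- by rewrite (le_trans (_ : _ <= expR p)) ?ler_expR ?h//; lra.
Qed.

(** Both sides are homogeneous of degree 3. The right-hand side is a product so that the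
    Cauchy-Schwarz inequality in u can separate its factors; b, which will be beta(s), occurs in one
    of them only and linearly, so that the result is integrable in s. This is possible as 2x <=
    1. *)
Lemma powR_trilinear x y z b g d : 0 < b -> 0 < g -> 0 < d ->
  0 <= x <= 1 / 2 -> 0 <= y <= 1 -> 0 <= z <= 1 -> x + y + z = 3 / 2 ->
  (b `^ x * g `^ y * d `^ z) ^+ 2 <= (b * g + b * d + g * d) * (g + d).
Proof.
move=> b0 g0 d0 /andP[x0 x1] /andP[y0 y1] /andP[z0 z1] xyz.
rewrite /powR !gt_eqF//.
have -> : b = expR (ln b) by rewrite lnK.
have -> : g = expR (ln g) by rewrite lnK.
have -> : d = expR (ln d) by rewrite lnK.
rewrite !expRK; move: (ln b) (ln g) (ln d) => {b0 g0 d0}b {}g {}d.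
have x2 : 0 < 1 + 2 * x by lra.
(* The square on the left is (bg)^X (bd)^Y (gd)^Z g^t d^(1 - t), where
   X = 2xt, Y = 2x(1 - t) and Z = 1 - 2x add up to 1. *)
pose t := (2 - 2 * z) / (1 + 2 * x).
(* 0 <= t amounts to z <= 1, and t <= 1 to y <= 1. *)
have t0 : 0 <= t by rewrite divr_ge0//; lra.
have t1 : t <= 1 by rewrite ler_pdivrMr//; lra.
have tx : t * (1 + 2 * x) = 2 - 2 * z by rewrite divfK// gt_eqF.
rewrite -!expRD -expRM_natl.
have -> : 2%:R * (x * b + y * g + z * d) =
    (2 * x * t * (b + g) + 2 * x * (1 - t) * (b + d) + (1 - 2 * x) * (g + d)) +
    (t * g + (1 - t) * d).
  have zE : z = 1 - t * (1 + 2 * x) / 2 by lra.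
  have yE : y = 3 / 2 - x - z by lra.
  by rewrite yE zE; field.
rewrite [leLHS]expRD; apply: ler_pM; rewrite ?expR_ge0//.
  apply: expR_mean3; [| | |ring].
  - by apply: mulr_ge0 => //; exact: mulr_ge0.
  - by apply: mulr_ge0; [exact: mulr_ge0|rewrite subr_ge0].
  - by lra.
by apply: expR_mean2; [|rewrite subr_ge0|ring].
Qed.

(* Since 0 `^ 0 = 1, powR would not vanish at 0 for e = 0, that is, for an infinite
   Lebesgue exponent; hpow does, so that densities may be cut off. *)
Definition hpow (v e : R) : R := if v == 0 then 0 else v `^ e.

Lemma hpow_ge0 v e : 0 <= hpow v e.
Proof. by rewrite /hpow; case: ifP => // _; exact: powR_ge0. Qed.

Lemma hpow_trilinear x y z b g d : 0 <= b -> 0 <= g -> 0 <= d ->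
  0 <= x <= 1 / 2 -> 0 <= y <= 1 -> 0 <= z <= 1 -> x + y + z = 3 / 2 ->
  hpow b x * hpow g y * hpow d z <=
  Num.sqrt (b * g + b * d + g * d) * Num.sqrt (g + d).
Proof.
move=> b0 g0 d0 xx yy zz xyz; rewrite /hpow.
have r0 : 0 <= Num.sqrt (b * g + b * d + g * d) * Num.sqrt (g + d).
  by rewrite mulr_ge0 ?sqrtr_ge0.
have [bE|bN] := eqVneq b 0; first by rewrite !mul0r.
have [gE|gN] := eqVneq g 0; first by rewrite mulr0 mul0r.
have [dE|dN] := eqVneq d 0; first by rewrite mulr0.
rewrite -sqrtrM; last by rewrite !addr_ge0 ?mulr_ge0.
rewrite -[leLHS]ger0_norm ?mulr_ge0 ?powR_ge0// -sqrtr_sqr ler_wsqrtr//.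
by apply: powR_trilinear => //; rewrite lt0r ?bN ?gN ?dN.
Qed.

Lemma measurable_conv (f g : R -> R) : measurable_fun setT f -> measurable_fun setT g ->
  measurable_fun setT (fun p : R * R => f p.2 * g (p.2 - p.1)).
Proof.
move=> mf mg; apply: measurable_funM; first exact: measurableT_comp.
by apply: (measurableT_comp mg); apply: measurable_funB.
Qed.

Lemma measurable_conv_int (f g : R -> R) : measurable_fun setT f -> measurable_fun setT g ->
  (forall u, 0 <= f u) -> (forall u, 0 <= g u) ->
  measurable_fun setT (fun s : R => \int[mu]_u (f u * g (u - s)%R)%:E)%E.
Proof.
move=> mf mg f0 g0.
apply: (@measurable_fun_fubini_tonelli_F _ _ _ _ R mu
  (fun p : R * R => (f p.2 * g (p.2 - p.1))%:E)).
- by apply/measurable_EFinP; exact: measurable_conv.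
- by move=> p; rewrite lee_fin mulr_ge0.
Qed.

(** The square is written as a product of extended reals, because the inner integral may be
    infinite. For the constant: the u-integrals of the two factors are at most 2 beta(s) + int
    gamma(u) delta(u - s) du and 2, whence 2 (2 + 1) = 6 after integration in s. *)
Theorem young_trilinear (A B C beta gamma delta : R -> R) x y z :
  measurable_fun setT A -> measurable_fun setT B -> measurable_fun setT C ->
  measurable_fun setT beta -> measurable_fun setT gamma -> measurable_fun setT delta ->
  (forall s, 0 <= A s) -> (forall s, 0 <= B s) -> (forall s, 0 <= C s) ->
  (forall s, 0 <= beta s) -> (forall s, 0 <= gamma s) -> (forall s, 0 <= delta s) ->
  (\int[mu]_s (beta s)%:E <= 1)%E -> (\int[mu]_s (gamma s)%:E <= 1)%E ->
  (\int[mu]_s (delta s)%:E <= 1)%E ->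
  {ae mu, forall s, A s <= hpow (beta s) x} ->
  {ae mu, forall s, B s <= hpow (gamma s) y} ->
  {ae mu, forall s, C s <= hpow (delta s) z} ->
  0 <= x <= 1 / 2 -> 0 <= y <= 1 -> 0 <= z <= 1 -> x + y + z = 3 / 2 ->
  (\int[mu]_s (((A s)%:E * \int[mu]_u (B u * C (u - s)%R)%:E) *
               ((A s)%:E * \int[mu]_u (B u * C (u - s)%R)%:E)) <= 6%:E)%E.
Proof.
move=> mA mB mC mb mg md A0 B0 C0 b0 g0 d0 ib ig id Ab Bg Cd xx yy zz xyz.
have mE (f : R -> R) : measurable_fun setT f -> measurable_fun setT (EFin \o f).
  by move=> mf; exact/measurable_EFinP.
have mds (s : R) : measurable_fun setT (fun u : R => delta (u - s)).
  exact: measurableT_comp (measurable_shift s).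
have mCs (s : R) : measurable_fun setT (fun u : R => C (u - s)).
  exact: measurableT_comp (measurable_shift s).
have ids (s : R) : (\int[mu]_u (delta (u - s)%R)%:E <= 1)%E.
  by rewrite (ge0_integral_shift s (mE _ md))// => u; rewrite lee_fin.
pose gd (s : R) := (\int[mu]_u (gamma u * delta (u - s)%R)%:E)%E.
have mgd : measurable_fun setT gd by exact: measurable_conv_int.
have gd0 s : (0 <= gd s)%E by apply: integral_ge0 => u _; rewrite lee_fin mulr_ge0.
(* By Tonelli's theorem and the reflection s |-> u - s, this is the product of the masses of gamma
   and delta. *)
have igd : (\int[mu]_s gd s <= 1)%E.
  rewrite /gd (@fubini_tonelli _ _ _ _ R mu mu (fun p : R * R => (gamma p.2 * delta (p.2 - p.1))%:E)).
  - apply: le_trans ig; apply: ge0_le_integral => //.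
    + by move=> u _; apply: integral_ge0 => s _; rewrite lee_fin mulr_ge0.
    + apply: (@measurable_fun_fubini_tonelli_G _ _ _ _ R mu
        (fun p : R * R => (gamma p.2 * delta (p.2 - p.1))%:E)).
      * by apply/measurable_EFinP; exact: measurable_conv.
      * by move=> p; rewrite lee_fin mulr_ge0.
    + exact: mE.
    + move=> u _ /=; under eq_integral do rewrite EFinM.
      rewrite ge0_integralZl//.
      * rewrite (ge0_integral_reflect u (mE _ md)); last by move=> ?; rewrite lee_fin.
        by rewrite -[leRHS]mule1 lee_wpmul2l// lee_fin.
      * apply/measurable_EFinP; exact: measurableT_comp (measurable_reflect u).
      * by move=> s _; rewrite lee_fin.
      * by rewrite lee_fin.
  - by apply/measurable_EFinP; exact: measurable_conv.
  - by move=> p; rewrite lee_fin mulr_ge0.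
have msqrt (f : R -> R) : measurable_fun setT f -> measurable_fun setT (fun u => Num.sqrt (f u)).
  have ms : measurable_fun setT (@Num.sqrt R).
    by apply: continuous_measurable_fun; exact: sqrt_continuous.
  by move=> mf; exact: (measurableT_comp ms mf).
have key : {ae mu, forall s,
    ((A s)%:E * \int[mu]_u (B u * C (u - s)%R)%:E) *
    ((A s)%:E * \int[mu]_u (B u * C (u - s)%R)%:E) <=
    (2%:E * ((2 * beta s)%:E + gd s))%E}%E.
  move: Ab; apply: filterS; first exact: (ae_filter_ringOfSetsType mu).
  move=> s As.
  pose U (u : R) := beta s * gamma u + beta s * delta (u - s) + gamma u * delta (u - s).
  pose V (u : R) := gamma u + delta (u - s).
  have mU : measurable_fun setT U.
    apply: measurable_funD; last exact: measurable_funM.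
    by apply: measurable_funD; apply: measurable_funM.
  have mV : measurable_fun setT V by exact: measurable_funD.
  have U0 u : 0 <= U u by rewrite !addr_ge0 ?mulr_ge0.
  have V0 u : 0 <= V u by rewrite addr_ge0.
  have le1 : ((A s)%:E * \int[mu]_u (B u * C (u - s)%R)%:E <=
      \int[mu]_u (Num.sqrt (U u) * Num.sqrt (V u))%:E)%E.
    rewrite -ge0_integralZl//; last 3 first.
    - by apply/measurable_EFinP; apply: measurable_funM => //; exact: mCs.
    - by move=> u _; rewrite lee_fin mulr_ge0.
    - by rewrite lee_fin.
    apply: ae_ge0_le_integral => //.
    - by move=> u _; rewrite -EFinM lee_fin !mulr_ge0.
    - apply: emeasurable_funM => //; apply/measurable_EFinP; apply: measurable_funM => //.
      exact: mCs.
    - apply/measurable_EFinP; exact: (measurable_funM (msqrt _ mU) (msqrt _ mV)).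
    move: Bg (ae_shift s Cd); apply: filterS2; first exact: (ae_filter_ringOfSetsType mu).
    move=> u Bu Cu _; rewrite -EFinM lee_fin mulrA.
    apply: le_trans (hpow_trilinear (b0 s) (g0 u) (d0 (u - s)) xx yy zz xyz).
    by rewrite !ler_pM ?mulr_ge0.
  apply: (@le_trans _ _ ((\int[mu]_u (U u)%:E) * (\int[mu]_u (V u)%:E))%E).
    have A1 : (0 <= (A s)%:E * \int[mu]_u (B u * C (u - s)%R)%:E)%E.
      apply: mule_ge0; rewrite ?lee_fin//.
      by apply: integral_ge0 => u _; rewrite lee_fin mulr_ge0.
    apply: (le_trans (lee_pmul A1 A1 le1 le1)).
    have := cauchy_schwarz mu (msqrt _ mU) (msqrt _ mV) (fun=> sqrtr_ge0 _) (fun=> sqrtr_ge0 _).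
    move=> /le_trans; apply.
    rewrite (_ : (\int[mu]_u (Num.sqrt (U u) ^+ 2)%:E = \int[mu]_u (U u)%:E)%E); last first.
      by apply: eq_integral => u _; rewrite sqr_sqrtr.
    rewrite (_ : (\int[mu]_u (Num.sqrt (V u) ^+ 2)%:E = \int[mu]_u (V u)%:E)%E)//.
    by apply: eq_integral => u _; rewrite sqr_sqrtr.
  rewrite muleC; apply: lee_pmul.
  - by apply: integral_ge0 => u _; rewrite lee_fin.
  - by apply: integral_ge0 => u _; rewrite lee_fin.
  - under eq_integral do rewrite EFinD.
    rewrite ge0_integralD//; last 4 first.
    + by move=> u _; rewrite lee_fin.
    + exact: mE.
    + by move=> u _; rewrite lee_fin.
    + exact: mE (mds s).
    by rewrite (_ : 2%:E = 1 + 1)%E ?leeD// -EFinD.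
  - under eq_integral do rewrite !EFinD.
    rewrite ge0_integralD//; last 4 first.
    + by move=> u _; rewrite -EFinD lee_fin addr_ge0// mulr_ge0.
    + by apply: emeasurable_funD; apply: mE; apply: measurable_funM => //; exact: mds.
    + by move=> u _; rewrite lee_fin mulr_ge0.
    + by apply: mE; apply: measurable_funM => //; exact: mds.
    rewrite leeD// ge0_integralD//; last 4 first.
    + by move=> u _; rewrite lee_fin mulr_ge0.
    + by apply: mE; apply: measurable_funM.
    + by move=> u _; rewrite lee_fin mulr_ge0.
    + by apply: mE; apply: measurable_funM => //; exact: mds.
    have bs (f : R -> R) : measurable_fun setT f -> (forall u, 0 <= f u) ->
        (\int[mu]_u (f u)%:E <= 1)%E -> (\int[mu]_u (beta s * f u)%:E <= (beta s)%:E)%E.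
      move=> mf f0 if1; under eq_integral do rewrite EFinM.
      rewrite ge0_integralZl//; last 3 first.
      * exact: mE.
      * by move=> u _; rewrite lee_fin.
      * by rewrite lee_fin.
      by rewrite -[leRHS]mule1 lee_wpmul2l// lee_fin.
    rewrite (_ : 2 * beta s = beta s + beta s); last by ring.
    by rewrite EFinD leeD// bs.
have mk : measurable_fun setT (fun s : R => \int[mu]_u (B u * C (u - s)%R)%:E)%E.
  exact: measurable_conv_int.
have k0 (s : R) : (0 <= \int[mu]_u (B u * C (u - s)%R)%:E)%E.
  by apply: integral_ge0 => u _; rewrite lee_fin mulr_ge0.
have mAk : measurable_fun setT (fun s : R => (A s)%:E * \int[mu]_u (B u * C (u - s)%R)%:E)%E.
  by apply: emeasurable_funM => //; exact: mE.
have m2b : measurable_fun setT (fun s : R => (2 * beta s)%:E).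
  by apply: mE; exact: measurable_funM.
apply: (@le_trans _ _ (\int[mu]_s (2%:E * ((2 * beta s)%:E + gd s)))%E).
  apply: ae_ge0_le_integral => //.
  - by move=> s _; rewrite !mule_ge0// lee_fin.
  - exact: emeasurable_funM.
  - by move=> s _; rewrite mule_ge0// adde_ge0// lee_fin mulr_ge0.
  - by apply: emeasurable_funM => //; exact: emeasurable_funD.
  move: key; apply: filterS; first exact: (ae_filter_ringOfSetsType mu).
  by move=> s h _; exact: h.
rewrite ge0_integralZl//; last 2 first.
- exact: emeasurable_funD.
- by move=> s _; rewrite adde_ge0// lee_fin mulr_ge0.
rewrite (_ : 6%:E = 2%:E * (2%:E + 1%:E))%E; last by rewrite -EFinD -EFinM; congr EFin; ring.
rewrite lee_wpmul2l// ge0_integralD//; last first.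
  by move=> s _; rewrite lee_fin mulr_ge0.
apply: leeD => //.
under eq_integral do rewrite EFinM.
rewrite ge0_integralZl//; last 2 first.
- exact: mE.
- by move=> s _; rewrite lee_fin.
by rewrite -[leRHS]mule1 lee_wpmul2l// lee_fin.
Qed.

End young.

(** * Envelopes of functions in a Lebesgue space *)

Section envelope.
Context {R : realType}.
Local Notation mu := (@lebesgue_measure R).

Lemma measurable_hpow (e : R) : measurable_fun setT (fun v : R => hpow v e).
Proof.
rewrite (_ : (fun v => _) = (fun v => \1_(~` [set 0]) v * v `^ e)).
  apply: measurable_funM; last exact: measurable_powR.
  by apply: measurable_indic; exact: measurableC.
apply/funext => v; rewrite /hpow indicE; case: eqVneq => [->|v0].
  by rewrite memNset ?mul0r//=; exact.
by rewrite mem_set ?mul1r//=; exact/eqP.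
Qed.

Lemma hpow_div (v l e : R) : 0 <= v -> 0 < l -> hpow (v / l) e = hpow v e / l `^ e.
Proof.
move=> v0 l0; rewrite /hpow mulf_eq0 invr_eq0 (gt_eqF l0) orbF.
case: ifP => _; first by rewrite mul0r.
by rewrite powRM ?invr_ge0 ?(ltW l0)// -powR_inv1 ?(ltW l0)// -powRrM mulN1r powRN.
Qed.

(** Membership in a Lebesgue space recast as a majorant by a power of a probability density.
    Positivity of beta on [0, T] allows finiteness at s to be deduced from bounds weighted by
    [hpow (beta s) x]. *)
Definition envelope (T x : R) (f : R -> R) (M : R) (beta : R -> R) : Prop :=
  [/\ 0 < M, measurable_fun setT beta,
    (forall s, 0 <= beta s) /\ (forall s, 0 <= s <= T -> 0 < beta s),
    (\int[mu]_s (beta s)%:E = 1)%E &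
    {ae mu, forall s, `|(f \_ `[0, T]) s| <= M * hpow (beta s) x}].

Lemma envelope_of_bound (T x M : R) (f B : R -> R) : 0 < T -> 0 < M ->
  measurable_fun setT B -> (forall s, 1 <= B s) ->
  (\int[mu]_s ((B \_ `[0, T]) s)%:E < +oo)%E ->
  {ae mu, forall s, `|(f \_ `[0, T]) s| <= M * (B s) `^ x} ->
  exists M' beta, envelope T x f M' beta.
Proof.
move=> T0 M0 mB B1 Bfin fB.
set D : set R := `[0, T]%classic in Bfin fB *.
have mD : measurable D by exact: measurable_itv.
pose L := fine (\int[mu]_s ((B \_ D) s)%:E).
have BD0 s : 0 <= (B \_ D) s.
  by rewrite /patch; case: ifP => // _; rewrite (le_trans ler01).
have i0 : (0 <= \int[mu]_s ((B \_ D) s)%:E)%E.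
  by apply: integral_ge0 => s _; rewrite lee_fin.
have iL : (\int[mu]_s ((B \_ D) s)%:E = L%:E)%E.
  by rewrite /L fineK// ge0_fin_numE.
have mBD : measurable_fun setT (B \_ D).
  exact: ((measurable_restrictT B mD).1 (measurable_funTS mB)).
have L0 : 0 < L.
  rewrite -lte_fin -iL; apply: (@lt_le_trans _ _ T%:E); first by rewrite lte_fin.
  apply: (@le_trans _ _ (\int[mu]_s (\1_D s)%:E)%E).
    by rewrite integral_indic// setIT /D [leRHS]lebesgue_measure_itv/= lte_fin T0 -EFinB subr0.
  apply: ge0_le_integral => //.
  - by apply/measurable_EFinP; exact: measurable_indic.
  - exact/measurable_EFinP.
  - move=> s _; rewrite lee_fin indicE /patch; case: ifP => // _.
exists (M * L `^ x), (fun s => (B \_ D) s / L); split.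
- by rewrite mulr_gt0// powR_gt0.
- exact: measurable_funM.
- split => s; first by rewrite divr_ge0// ltW.
  by move=> sT; rewrite divr_gt0// /patch mem_setE in_itv/= sT (lt_le_trans ltr01).
- under eq_integral do rewrite mulrC EFinM.
  rewrite ge0_integralZl//.
  + by rewrite iL -EFinM mulVf// gt_eqF.
  + exact/measurable_EFinP.
  + by move=> s _; rewrite lee_fin.
  + by rewrite lee_fin invr_ge0 ltW.
move: fB; apply: filterS; first exact: (ae_filter_ringOfSetsType mu).
move=> s fB; rewrite hpow_div//.
have -> : M * L `^ x * (hpow ((B \_ D) s) x / L `^ x) = M * hpow ((B \_ D) s) x.
  by field; rewrite gt_eqF// powR_gt0.
move: fB; rewrite /patch; case: ifPn => sD fB.
  by rewrite /hpow gt_eqF ?(lt_le_trans ltr01)//.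
by rewrite normr0 mulr_ge0 ?hpow_ge0// ltW.
Qed.

(** For finite p = r the majorant is built on B = 1 + |f|^r: as B >= 1 and 1/r <= x, |f| <= B^(1/r)
    <= B^x, and B is integrable because [0, T] is bounded. For p infinite, B = 1 and the constant
    bounds the essential supremum. *)
Lemma Lp_envelope (T x : R) (p : \bar R) (f : R -> R) : 0 < T -> (1%:E <= p)%E ->
  (p^-1 <= x%:E)%E -> Lp_on `[0, T] p f -> exists M beta, envelope T x f M beta.
Proof.
move=> T0; case: p => [r| |]//.
- rewrite lee_fin => r1; have r0 : 0 < r := lt_le_trans ltr01 r1.
  rewrite inver gt_eqF// lee_fin => rx Lf.
  have mf : measurable_fun setT (f \_ `[0, T]).
    by move: Lf; rewrite /Lp_on inE => /andP[]; rewrite inE.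
  have mfr : measurable_fun setT (fun s => `|(f \_ `[0, T]) s| `^ r).
    have m1 : measurable_fun setT (fun s => `|(f \_ `[0, T]) s|) by exact: measurableT_comp.
    exact: (measurableT_comp (@measurable_powR R r) m1).
  pose B s := 1 + `|(f \_ `[0, T]) s| `^ r.
  have B1 s : 1 <= B s by rewrite lerDl powR_ge0.
  apply: (@envelope_of_bound T x 1 f B) => //.
  + exact: measurable_funD.
  + apply: (@le_lt_trans _ _ (\int[mu]_s ((\1_(`[0%R, T]%classic) s)%:E +
       (`|(f \_ `[0, T]) s| `^ r)%:E))%E).
      apply: ge0_le_integral => //.
      * by move=> s _; rewrite lee_fin /patch; case: ifP => // _; exact: le_trans (B1 s).
      * apply/measurable_EFinP; apply: ((measurable_restrictT B (measurable_itv _)).1 _).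
        by apply: measurable_funTS; exact: measurable_funD.
      * apply: emeasurable_funD; apply/measurable_EFinP => //.
      * move=> s _; rewrite -EFinD lee_fin {1}/patch indicE mem_setE.
        by case: ifPn => // _; rewrite addr_ge0// powR_ge0.
    rewrite ge0_integralD//.
    + rewrite lte_add_pinfty//.
        rewrite integral_indic// setIT [ltLHS]lebesgue_measure_itv/=.
        by rewrite lte_fin T0 -EFinB ltry.
      have /integrableP[_] := Lfun_integrable r1 Lf.
      by under eq_integral do rewrite gee0_abs ?lee_fin ?powR_ge0//.
    + exact/measurable_EFinP.
    + exact/measurable_EFinP.
  + apply: aeW => s; rewrite mul1r.
    have h0 : `|(f \_ `[0, T]) s| = (`|(f \_ `[0, T]) s| `^ r) `^ r^-1.
      by rewrite -powRrM mulfV ?gt_eqF// powRr1.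
    rewrite h0; apply: (@le_trans _ _ (B s `^ r^-1)).
      by rewrite ge0_ler_powR ?invr_ge0 ?(ltW r0)// ?nnegrE ?powR_ge0 ?(le_trans ler01)// lerDr.
    by rewrite ler_powR.
- move=> _ _ Lf.
  have : (Lnorm mu +oo (EFin \o (f \_ `[0%R, T])) < +oo)%E.
    by move: Lf; rewrite /Lp_on inE => /andP[_]; rewrite inE.
  have muT : (0 < mu [set: R])%E.
    apply: (@lt_le_trans _ _ (mu `[0, T]%classic)); last by apply: le_measure; rewrite ?inE.
    by rewrite [ltRHS]lebesgue_measure_itv/= lte_fin T0 -EFinB subr0 lte_fin.
  rewrite unlock muT => sup_fin.
  have [M0 M00 M0sup] : exists2 M0 : R, 0 < M0 &
      (ess_sup mu (abse \o (EFin \o (f \_ `[0%R, T]))) <= M0%:E)%E.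
    move: sup_fin; case: (ess_sup _ _) => [v| |]// _.
      exists (`|v| + 1); first by rewrite ltr_pwDr.
      by rewrite lee_fin (le_trans (ler_norm _))// lerDl.
    by exists 1 => //; exact: leNye.
  apply: (@envelope_of_bound T x M0 f (cst 1)) => //.
  + rewrite (_ : (\int[mu]_s _ = \int[mu]_s (\1_(`[0%R, T]%classic) s)%:E)%E); last first.
      by apply: eq_integral => s _; rewrite indic_restrict.
    rewrite integral_indic// setIT [ltLHS]lebesgue_measure_itv/=.
    by rewrite lte_fin T0 -EFinB ltry.
  + have /ess_supP := M0sup; apply: filterS => s.
    by rewrite powR1 mulr1 lee_fin.
Qed.

(** The exponent y governs the modulus of continuity, so it is taken as large as possible with x =
    px, namely min (1, 3/2 - px - rx); z absorbs what is left. *)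
Lemma exists_exponents (px qx rx : R) : 0 <= px <= 1 / 2 -> 0 <= qx <= 1 -> 0 <= rx <= 1 ->
  px + qx + rx <= 3 / 2 -> exists x y z,
  [/\ [/\ px <= x, qx <= y & rx <= z],
      [/\ 0 <= x <= 1 / 2, 0 <= y <= 1 & 0 <= z <= 1],
      x + y + z = 3 / 2 & (px + rx < 3 / 2 -> 0 < y)].
Proof.
move=> /andP[p0 p1] /andP[q0 q1] /andP[r0 r1] s.
have [h|h] := leP 1 (3 / 2 - px - rx).
  exists px, 1, (1 / 2 - px); split; [split|split| |]; lra.
exists px, (3 / 2 - px - rx), rx; split; [split|split| |]; lra.
Qed.

Lemma inve_bound (p : \bar R) (k : R) : 0 < k -> (k%:E <= p)%E ->
  exists px : R, (p^-1 = px%:E)%E /\ 0 <= px <= k^-1.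
Proof.
move=> k0; case: p => [r| |]//.
  rewrite lee_fin => kr; have r0 := lt_le_trans k0 kr.
  exists r^-1; rewrite inver gt_eqF//; split => //.
  by rewrite invr_ge0 (ltW r0)/= lef_pV2.
by move=> _; exists 0; rewrite lexx invr_ge0 ltW.
Qed.

End envelope.

(** * Bounds on the Volterra kernel *)

Section volterra_bound.
Context {R : realType}.
Local Notation mu := (@lebesgue_measure R).
Variables (T : R) (a b c : R -> R) (Ma Mb Mc : R) (beta gamma delta : R -> R) (x y z : R).
Local Notation a0 := (a \_ `[0, T]).
Local Notation b0 := (b \_ `[0, T]).
Local Notation c0 := (c \_ `[0, T]).
Hypotheses (ma : measurable_fun setT a0) (mb : measurable_fun setT b0)
  (mc : measurable_fun setT c0).
Hypotheses (ea : envelope T x a Ma beta) (eb : envelope T y b Mb gamma)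
  (ec : envelope T z c Mc delta).
Hypotheses (xx : 0 <= x <= 1 / 2) (yy : 0 <= y <= 1) (zz : 0 <= z <= 1)
  (xyz : x + y + z = 3 / 2).

(** Cutting b and c off to [0, T] leaves I as the only place where t enters; an increment of the
    kernel in t is then a change of I. *)
Definition restr_conv_abs (I : set R) (s : R) : \bar R :=
  (\int[mu]_u (`|b0 u| * \1_I u * `|c0 (u - s)|)%:E)%E.

Definition restr_conv (I : set R) (s : R) : R :=
  fine (\int[mu]_u (b0 u * \1_I u * c0 (u - s))%:E)%E.

Lemma measurable_bI (I : set R) : measurable I -> measurable_fun setT (fun u => b0 u * \1_I u).
Proof. by move=> mI; apply: measurable_funM. Qed.

Lemma measurable_abI (I : set R) : measurable I -> measurable_fun setT (fun u => `|b0 u| * \1_I u).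
Proof. by move=> mI; apply: measurable_funM => //; exact: measurableT_comp. Qed.

Lemma measurable_ac : measurable_fun setT (fun u => `|c0 u|).
Proof. exact: measurableT_comp. Qed.

Lemma measurable_restr_conv_abs (I : set R) : measurable I -> measurable_fun setT (restr_conv_abs I).
Proof.
move=> mI; apply: (measurable_conv_int (measurable_abI mI) measurable_ac) => u //.
Qed.

Lemma restr_conv_abs_ge0 (I : set R) (s : R) : (0 <= restr_conv_abs I s)%E.
Proof. by apply: integral_ge0 => u _; rewrite lee_fin !mulr_ge0. Qed.

(** On I, gamma may be replaced by gamma 1_I / l, still of mass at most 1; its power y produces the
    factor l^y. *)
Lemma restr_conv_abs_bound (I : set R) (l : R) : measurable I -> 0 < l ->
  (\int[mu]_(u in I) (gamma u)%:E <= l%:E)%E ->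
  (\int[mu]_s (((hpow (beta s) x)%:E * restr_conv_abs I s) *
    ((hpow (beta s) x)%:E * restr_conv_abs I s)) <= (6 * (Mb * Mc * l `^ y) ^+ 2)%:E)%E.
Proof.
move=> mI l0 gl.
have [_ mbeta [beta0 _] ibeta _] := ea.
have [Mb0 mgamma [gamma0 _] igamma bg] := eb.
have [Mc0 mdelta [delta0 _] idelta cd] := ec.
have ly0 : 0 < l `^ y by exact: powR_gt0.
pose A s := hpow (beta s) x.
pose B u := `|b0 u| * \1_I u / (Mb * l `^ y).
pose C w := `|c0 w| / Mc.
pose K := Mb * Mc * l `^ y.
have K0 : 0 < K by rewrite !mulr_gt0.
have mA : measurable_fun setT A by exact: (measurableT_comp (measurable_hpow x) mbeta).
have mB : measurable_fun setT B by apply: measurable_funM => //; exact: measurable_abI.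
have mC : measurable_fun setT C by apply: measurable_funM => //; exact: measurable_ac.
have A0 s : 0 <= A s by exact: hpow_ge0.
have B0 s : 0 <= B s by rewrite divr_ge0 ?mulr_ge0// ltW.
have C0 s : 0 <= C s by rewrite divr_ge0// ltW.
have mgI : measurable_fun setT (fun u => gamma u * \1_I u / l).
  by do 2 apply: measurable_funM => //.
have gI0 s : 0 <= gamma s * \1_I s / l by rewrite divr_ge0 ?mulr_ge0// ltW.
have igI : (\int[mu]_s (gamma s * \1_I s / l)%:E <= 1)%E.
  under eq_integral do rewrite mulrC EFinM.
  rewrite ge0_integralZl//.
  - rewrite lee_pdivrMl// mule1; apply: le_trans gl.
    rewrite [leRHS]integral_mkcond le_eqVlt; apply/orP; left; apply/eqP.
    by apply: eq_integral => u _; rewrite /patch indicE; case: ifP => _; rewrite ?mulr1 ?mulr0.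
  - by apply/measurable_EFinP; apply: measurable_funM.
  - by move=> s _; rewrite lee_fin mulr_ge0.
  - by rewrite lee_fin invr_ge0 ltW.
have kE s : restr_conv_abs I s = (K%:E * \int[mu]_u (B u * C (u - s)%R)%:E)%E.
  rewrite -ge0_integralZl//.
  - apply: eq_integral => u _; rewrite -EFinM; congr EFin.
    by rewrite /K /B /C; field; rewrite !gt_eqF.
  - apply/measurable_EFinP; apply: measurable_funM => //.
    exact: (measurableT_comp mC (measurable_shift s)).
  - by move=> u _; rewrite lee_fin mulr_ge0.
  - by rewrite lee_fin ltW.
have mBC : measurable_fun setT (fun s : R => \int[mu]_u (B u * C (u - s)%R)%:E)%E.
  exact: measurable_conv_int.
have BC0 (s : R) : (0 <= \int[mu]_u (B u * C (u - s)%R)%:E)%E.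
  by apply: integral_ge0 => u _; rewrite lee_fin mulr_ge0.
rewrite (_ : (\int[mu]_s _ = \int[mu]_s ((K ^+ 2)%:E *
    (((A s)%:E * \int[mu]_u (B u * C (u - s)%R)%:E) *
     ((A s)%:E * \int[mu]_u (B u * C (u - s)%R)%:E)))%E)%E); last first.
  apply: eq_integral => s _; rewrite kE expr2 EFinM.
  by rewrite [((hpow _ _)%:E * _)%E]muleCA muleACA.
rewrite ge0_integralZl//.
- rewrite -/K (_ : (6 * K ^+ 2)%:E = (K ^+ 2)%:E * 6%:E)%E; last by rewrite -EFinM mulrC.
  apply: lee_wpmul2l; first by rewrite lee_fin sqr_ge0.
  apply: (@young_trilinear R A B C beta (fun u => gamma u * \1_I u / l) delta x y z) => //.
  + by rewrite ibeta.
  + by rewrite idelta.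
  + by apply: aeW => s; exact: lexx.
  + move: bg; apply: filterS; first exact: (ae_filter_ringOfSetsType mu).
    move=> u bg; rewrite /B indicE; case: (u \in I); last by rewrite mulr0 mul0r hpow_ge0.
    rewrite !mulr1 hpow_div// ler_pdivrMr ?mulr_gt0//.
    by rewrite mulrACA (mulrC _ Mb) -mulrA mulVf ?mulr1 ?gt_eqF.
  + move: cd; apply: filterS; first exact: (ae_filter_ringOfSetsType mu).
    by move=> u cd; rewrite ler_pdivrMr// mulrC.
- by apply: emeasurable_funM; apply: emeasurable_funM => //; exact/measurable_EFinP.
- by move=> s _; rewrite !mule_ge0// lee_fin.
- by rewrite lee_fin sqr_ge0.
Qed.

(** The weighted square is integrable, hence almost everywhere finite, and the weight is positive on
    [0, T]. With a as weight nothing would follow at the zeros of a. *)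
Lemma restr_conv_abs_fin : {ae mu, forall s, 0 <= s <= T -> (restr_conv_abs `[0%R, T] s < +oo)%E}.
Proof.
have [_ mbeta [beta0 betaT] ibeta _] := ea.
have [_ _ [gamma0 _] igamma _] := eb.
have [_ mgamma _ _ _] := eb.
have g1 : (\int[mu]_(u in `[0%R, T]) (gamma u)%:E <= 1%:E)%E.
  rewrite -igamma; apply: ge0_subset_integral => //; first exact/measurable_EFinP.
  by move=> u _; rewrite lee_fin.
have mA : measurable_fun setT (fun s => (hpow (beta s) x)%:E).
  by apply/measurable_EFinP; exact: (measurableT_comp (measurable_hpow x) mbeta).
have mI : measurable (`[0, T]%classic : set R) by exact: measurable_itv.
have := restr_conv_abs_bound mI ltr01 g1.
set G := (fun s => _); move=> Gfin.
have iG : mu.-integrable setT G.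
  apply/integrableP; split.
    by apply: emeasurable_funM; apply: emeasurable_funM => //; exact: measurable_restr_conv_abs.
  apply: le_lt_trans (ltry _); apply: le_trans Gfin.
  under eq_integral => s _ do rewrite gee0_abs ?mule_ge0 ?lee_fin ?hpow_ge0 ?restr_conv_abs_ge0//.
  by [].
have := integrable_ae measurableT iG.
apply: filterS.
move=> s /(_ I) Gs sT; rewrite ltey; apply/eqP => k_oo; move: Gs.
rewrite /G k_oo gt0_muley ?mulyy//.
by rewrite lte_fin /hpow gt_eqF ?betaT// powR_gt0// betaT.
Qed.

(** The factor c0 (u - s) vanishes for u < s, so integrating over [0, t] is integrating over [s, t],
    and gives 0 when s > t. Equal integrals have equal finite parts, so the identity holds for every
    s, integrable or not. *)
Lemma volterraE (t : R) : 0 <= t <= T ->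
  (volterra a b c t) \_ `[0, t] = fun s => a0 s * restr_conv `[0, t] s.
Proof.
move=> /andP[t0 tT]; apply/funext => s.
have [st|st] := boolP (s \in `[0, t]%classic); last first.
  rewrite {1}/patch (negbTE st).
  have [s0|s0] := ltP s 0.
    by rewrite /patch mem_setE in_itv/= leNgt s0/= mul0r.
  have ts : t < s by move: st; rewrite mem_setE in_itv/= s0/= -ltNge.
  rewrite /restr_conv [X in fine X]integral0_eq ?mulr0 // => u _.
  rewrite indicE mem_setE in_itv/=; have [/andP[u0 ut]|_] := boolP (0 <= u <= t); last by rewrite mulr0 mul0r.
  rewrite {2}/patch mem_setE in_itv/= subr_ge0 leNgt (le_lt_trans ut ts)/=.
  by rewrite mulr0.
rewrite {1}/patch st; move: st; rewrite mem_setE in_itv/= => /andP[s0 st].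
rewrite /volterra {1}/patch mem_setE in_itv/= s0 (le_trans st tT)/=.
congr (_ * _); rewrite /Rintegral /restr_conv; congr fine; rewrite integral_mkcond.
apply: eq_integral => u _; rewrite [LHS]/patch mem_setE in_itv/= indicE mem_setE in_itv/=.
have [su|us] := leP s u => /=; last first.
  by rewrite {2}/patch mem_setE in_itv/= subr_ge0 [s <= u]leNgt us/= mulr0.
rewrite (le_trans s0 su)/=; case: ifP => ut; last by rewrite mulr0 mul0r.
rewrite mulr1 /patch !mem_setE !in_itv/= (le_trans s0 su) (le_trans ut tT) subr_ge0 su/=.
by rewrite lerBlDr (le_trans ut)// (le_trans tT)// lerDl.
Qed.

(** Tonelli's theorem is applied to the positive and negative parts, since the integral may fail to
    converge absolutely for some s. *)
Lemma measurable_restr_conv (I : set R) : measurable I -> measurable_fun setT (restr_conv I).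
Proof.
move=> mI.
pose G (p : R * R) := (b0 p.2 * \1_I p.2 * c0 (p.2 - p.1))%:E.
have mG : measurable_fun setT G.
  by apply/measurable_EFinP; exact: (measurable_conv (measurable_bI mI) mc).
rewrite (_ : restr_conv I = fun s => fine ((\int[mu]_u G^\+ (s, u))%E - (\int[mu]_u G^\- (s, u))%E)%E).
  apply: (measurableT_comp (fine_measurable measurableT)).
  apply: emeasurable_funB.
  - apply: (@measurable_fun_fubini_tonelli_F _ _ _ _ R mu G^\+%E) => //.
    exact: measurable_funepos.
  - apply: (@measurable_fun_fubini_tonelli_F _ _ _ _ R mu G^\-%E) => //.
    exact: measurable_funeneg.
apply/funext => s; rewrite /restr_conv [in LHS]integralE; congr (fine (_ - _)%E); apply: eq_integral => u _; by rewrite ?funeposE ?funenegE.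
Qed.

Lemma restr_conv_le (I : set R) (s : R) : measurable I -> (`|restr_conv I s|%:E <= restr_conv_abs I s)%E.
Proof.
move=> mI; rewrite /restr_conv.
have mf : measurable_fun setT (fun u => (b0 u * \1_I u * c0 (u - s))%:E).
  apply/measurable_EFinP; apply: measurable_funM; first exact: measurable_bI.
  exact: (measurableT_comp mc (measurable_shift s)).
have h (v : \bar R) : (`|fine v|%:E <= `|v|)%E by case: v => [r| |]//=; rewrite ?normr0 ?leey.
apply: (le_trans (h _)); apply: (le_trans (le_abse_integral mu measurableT mf)).
rewrite /restr_conv_abs le_eqVlt; apply/orP; left; apply/eqP; apply: eq_integral => u _.
by rewrite /= !normrM [`|\1_I u|]ger0_norm.
Qed.

Lemma restr_conv_sqr_bound (I : set R) (l : R) : measurable I -> 0 < l ->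
  (\int[mu]_(u in I) (gamma u)%:E <= l%:E)%E ->
  (\int[mu]_s ((a0 s * restr_conv I s) ^+ 2)%:E <= (6 * (Ma * Mb * Mc) ^+ 2 * (l `^ y) ^+ 2)%:E)%E.
Proof.
move=> mI l0 gl.
have [Ma0 mbeta _ _ ab] := ea.
have := restr_conv_abs_bound mI l0 gl.
set G := (fun s => _); move=> Gle.
have mA : measurable_fun setT (fun s => (hpow (beta s) x)%:E).
  by apply/measurable_EFinP; exact: (measurableT_comp (measurable_hpow x) mbeta).
have G0 s : (0 <= G s)%E by rewrite !mule_ge0 ?lee_fin ?hpow_ge0 ?restr_conv_abs_ge0.
have mG : measurable_fun setT G.
  by apply: emeasurable_funM; apply: emeasurable_funM => //; exact: measurable_restr_conv_abs.
apply: (@le_trans _ _ (\int[mu]_s ((Ma ^+ 2)%:E * G s))%E); last first.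
  rewrite ge0_integralZl// ?lee_fin ?sqr_ge0//.
  apply: (le_trans (lee_wpmul2l _ Gle)); first by rewrite lee_fin sqr_ge0.
  rewrite -EFinM lee_fin le_eqVlt; apply/orP; left; apply/eqP; ring.
apply: ae_ge0_le_integral => //.
- by move=> s _; rewrite lee_fin sqr_ge0.
- apply/measurable_EFinP; apply: measurable_funX; apply: measurable_funM => //.
  exact: measurable_restr_conv.
- by move=> s _; rewrite mule_ge0// lee_fin sqr_ge0.
- exact: emeasurable_funM.
move: ab; apply: filterS; first exact: (ae_filter_ringOfSetsType mu).
move=> s ab _; rewrite -[_ ^+ 2]real_normK ?num_real// normrM expr2 EFinM.
have h : ((`|a0 s| * `|restr_conv I s|)%:E <= Ma%:E * ((hpow (beta s) x)%:E * restr_conv_abs I s))%E.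
  rewrite EFinM muleA -[(Ma%:E * _)%E]EFinM; apply: lee_pmul; rewrite ?lee_fin//.
  exact: restr_conv_le.
rewrite (_ : (Ma ^+ 2)%:E * G s = (Ma%:E * ((hpow (beta s) x)%:E * restr_conv_abs I s)) *
   (Ma%:E * ((hpow (beta s) x)%:E * restr_conv_abs I s)))%E; last first.
  by rewrite expr2 EFinM /G muleACA.
by apply: lee_pmul; rewrite ?lee_fin ?mulr_ge0.
Qed.

Lemma integrable_restr_conv (I : set R) (s : R) : measurable I -> I `<=` `[0, T]%classic ->
  (restr_conv_abs `[0%R, T] s < +oo)%E ->
  mu.-integrable setT (fun u => (b0 u * \1_I u * c0 (u - s))%:E).
Proof.
move=> mI IT kfin; apply/integrableP; split.
  apply/measurable_EFinP; apply: measurable_funM; first exact: measurable_bI.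
  exact: (measurableT_comp mc (measurable_shift s)).
apply: le_lt_trans kfin; apply: ge0_le_integral => //.
- apply: measurableT_comp => //.
  apply/measurable_EFinP; apply: measurable_funM; first exact: measurable_bI.
  exact: (measurableT_comp mc (measurable_shift s)).
- apply/measurable_EFinP; apply: measurable_funM; first exact: measurable_abI.
  exact: (measurableT_comp measurable_ac (measurable_shift s)).
- move=> u _; rewrite /= lee_fin !normrM ler_wpM2r// ler_wpM2l//.
  rewrite !indicE; case: (boolP (u \in I)) => uI; rewrite ?normr0//.
  by rewrite mem_set ?normr1//; apply: IT; exact: set_mem.
Qed.

Lemma restr_conv_diff (s t' t : R) : 0 <= t' <= t -> t <= T -> (restr_conv_abs `[0%R, T] s < +oo)%E ->
  restr_conv `[0, t] s - restr_conv `[0, t'] s = restr_conv `]t', t] s.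
Proof.
move=> /andP[t'0 t't] tT kfin.
have s1 : `[0, t']%classic `<=` `[0, T]%classic.
  by move=> u /=; rewrite !in_itv/= => /andP[-> h]; rewrite (le_trans h)// (le_trans t't).
have s2 : `]t', t]%classic `<=` `[0, T]%classic.
  by move=> u /=; rewrite !in_itv/= => /andP[h1 h2]; rewrite (le_trans h2)// andbT (le_trans t'0)// ltW.
have i1 := integrable_restr_conv (measurable_itv _) s1 kfin.
have i2 := integrable_restr_conv (measurable_itv _) s2 kfin.
apply/eqP; rewrite subr_eq /restr_conv -fineD; last 2 first.
- exact: integrable_fin_num.
- exact: integrable_fin_num.
rewrite -integralD//; apply/eqP; congr fine; apply: eq_integral => u _.
rewrite -EFinD -mulrDl -mulrDr; congr ((_ * _ * _)%:E).
rewrite !indicE !mem_setE !in_itv/=.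
have [u0|u0] := leP 0 u => /=; last first.
  by rewrite [t' < u]ltNge (le_trans (ltW u0))//= addr0.
have [ut'|t'u] := leP u t' => /=; last by rewrite addr0.
by rewrite (le_trans ut' t't) add0r.
Qed.

Lemma volterra_integrable (t : R) : 0 <= t <= T ->
  {ae mu, forall s : R, (0 <= s <= t)%R ->
    mu.-integrable `[s, t] (fun u => (b u * c (u - s)%R)%:E)}.
Proof.
move=> /andP[t0 tT]; have := restr_conv_abs_fin.
apply: filterS; first exact: (ae_filter_ringOfSetsType mu).
move=> s kfin /andP[s0 st].
have := integrable_restr_conv (I := `[s, t]%classic) (measurable_itv _) _ (kfin _).
rewrite s0 (le_trans st tT) => /(_ _ isT) H.
have sub : `[s, t]%classic `<=` `[0, T]%classic.
  by move=> u /=; rewrite !in_itv/= => /andP[h1 h2]; rewrite (le_trans s0 h1) (le_trans h2 tT).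
apply: (@eq_integrable _ _ _ mu _ _
  (fun u => (b0 u * \1_(`[s, t]%classic) u * c0 (u - s))%:E)) => //; last first.
  by apply: (integrableS _ _ _ (H sub)).
move=> u; rewrite mem_setE in_itv/= => /andP[su ut].
rewrite indicE mem_setE in_itv/= su ut mulr1 /patch !mem_setE !in_itv/=.
rewrite (le_trans s0 su) (le_trans ut tT) subr_ge0 su/=.
by rewrite lerBlDr (le_trans ut)// (le_trans tT)// lerDl.
Qed.

Lemma volterra_sqr_bound (t : R) : 0 <= t <= T ->
  measurable_fun setT ((volterra a b c t) \_ `[0, t]) /\
  (\int[mu]_s (((volterra a b c t) \_ `[0, t]) s ^+ 2)%:E <= (6 * (Ma * Mb * Mc) ^+ 2)%:E)%E.
Proof.
move=> tT; rewrite volterraE//.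
have [_ mgamma [gamma0 _] igamma _] := eb.
split; first by apply: measurable_funM => //; exact: measurable_restr_conv.
have g1 : (\int[mu]_(u in `[0%R, t]) (gamma u)%:E <= 1%:E)%E.
  rewrite -igamma; apply: ge0_subset_integral => //; first exact/measurable_EFinP.
  by move=> u _; rewrite lee_fin.
have := restr_conv_sqr_bound (measurable_itv `[0, t]) ltr01 g1.
by rewrite powR1 expr1n mulr1.
Qed.

Lemma volterra_increment (t' t l : R) : 0 <= t' <= t -> t <= T -> 0 < l ->
  (\int[mu]_(u in `]t', t]) (gamma u)%:E <= l%:E)%E ->
  (\int[mu]_s ((((volterra a b c t) \_ `[0, t]) s - ((volterra a b c t') \_ `[0, t']) s) ^+ 2)%:E
    <= (6 * (Ma * Mb * Mc) ^+ 2 * (l `^ y) ^+ 2)%:E)%E.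
Proof.
move=> /andP[t'0 t't] tT l0 gl.
have t0T : 0 <= t <= T by rewrite (le_trans t'0 t't).
have t'T : 0 <= t' <= T by rewrite t'0 (le_trans t't).
apply: le_trans (restr_conv_sqr_bound (measurable_itv `]t', t]) l0 gl).
have mc' I : measurable I -> measurable_fun setT (fun s => a0 s * restr_conv I s).
  by move=> mI; apply: measurable_funM => //; exact: measurable_restr_conv.
rewrite !volterraE//; apply: ae_ge0_le_integral => //.
- by move=> s _; rewrite lee_fin sqr_ge0.
- by apply/measurable_EFinP; apply: measurable_funX; apply: measurable_funB; apply: mc'.
- by move=> s _; rewrite lee_fin sqr_ge0.
- by apply/measurable_EFinP; apply: measurable_funX; apply: mc'.
(* Additivity in I needs a finite integral, hence holds for almost every s in [0, T]; elsewhere a0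
   is 0. *)
have := restr_conv_abs_fin; apply: filterS; first exact: (ae_filter_ringOfSetsType mu).
move=> s kfin _; have [sT|sT] := boolP (0 <= s <= T).
  by rewrite -mulrBr restr_conv_diff ?t'0// kfin.
by rewrite /patch mem_setE in_itv/= (negbTE sT) !mul0r subrr.
Qed.

End volterra_bound.

(** * The Volterra Gaussian process *)

(** As h <= 1 and 2my >= 4, the factor (h^y)^(2m) is at most h^4. *)
Lemma powR_moment_bound (R : realType) (C K L h y : R) (m : nat) :
  0 <= C -> 0 <= K -> 0 < L -> 0 < h <= 1 -> 4 <= y * m.*2%:R ->
  C * (4 * (K * ((L * h) `^ y) ^+ 2)) ^+ m <=
  C * (4 * K) ^+ m * (L `^ y) ^+ m.*2 * h ^+ 4.
Proof.
move=> C0 K0 L0 h01 my; have /andP[h0 h1] := h01.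
have -> : C * (4 * (K * ((L * h) `^ y) ^+ 2)) ^+ m =
    C * (4 * K) ^+ m * (L `^ y) ^+ m.*2 * (h `^ y) ^+ m.*2.
  rewrite powRM ?(ltW L0) ?(ltW h0)// -mul2n !exprM -!(mulrA C) -!exprMn.
  by congr (_ * _ ^+ _); ring.
apply: ler_wpM2l.
  by rewrite mulr_ge0 ?exprn_ge0 ?powR_ge0// mulr_ge0// exprn_ge0// mulr_ge0.
rewrite -[leLHS]powR_mulrn ?powR_ge0// -powRrM -powR_mulrn ?(ltW h0)//.
exact: ger_powR.
Qed.

Section assembly.
Context {R : realType} {d : measure_display} {Omega : measurableType d}
  {P : probability Omega R}.
Variable W : R -> {RV P >-> R}.
Hypothesis hW : wiener_process W.
Local Notation mu := (@lebesgue_measure R).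
Variables (T : R) (a b c : R -> R) (Ma Mb Mc : R) (beta gamma delta : R -> R) (x y z : R).
Hypothesis T0 : 0 < T.
Hypotheses (ma : measurable_fun setT (a \_ `[0, T]))
  (mb : measurable_fun setT (b \_ `[0, T])) (mc : measurable_fun setT (c \_ `[0, T])).
Hypotheses (ea : envelope T x a Ma beta) (eb : envelope T y b Mb gamma)
  (ec : envelope T z c Mc delta).
Hypotheses (xx : 0 <= x <= 1 / 2) (yy : 0 <= y <= 1) (zz : 0 <= z <= 1)
  (xyz : x + y + z = 3 / 2).
Let K : R := 6 * (Ma * Mb * Mc) ^+ 2.

Let K0 : 0 < K.
Proof.
have [a0 _ _ _ _] := ea; have [b0 _ _ _ _] := eb; have [c0 _ _ _ _] := ec.
by rewrite mulr_gt0// exprn_gt0// !mulr_gt0.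
Qed.

Lemma norm2_volterra_le (t : R) : 0 <= t <= T ->
  (norm2_on `[0%R, t] (volterra a b c t) <= (Num.sqrt K)%:E)%E.
Proof.
move=> tT; rewrite /norm2_on Lnorm2_le ?sqrtr_ge0// (sqr_sqrtr (ltW K0)).
by have [] := volterra_sqr_bound ma mb mc ea eb ec xx yy zz xyz tT.
Qed.

Lemma Lp2_volterra (t : R) : 0 <= t <= T -> Lp_on `[0, t] 2%:E (volterra a b c t).
Proof.
move=> tT; rewrite /Lp_on inE; apply/andP; split; rewrite inE/=.
  by have [] := volterra_sqr_bound ma mb mc ea eb ec xx yy zz xyz tT.
exact: le_lt_trans (norm2_volterra_le tT) (ltry _).
Qed.

Let Gamma (t : R) : R := (\int[mu]_(u in `[0, t]) gamma u)%R.

Let integrable_gamma (A : set R) : measurable A -> mu.-integrable A (EFin \o gamma).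
Proof.
move=> mA; have [_ mg [g0 _] ig _] := eb.
apply: (@integrableS _ _ _ mu setT) => //.
apply/integrableP; split; first exact/measurable_EFinP.
under eq_integral do rewrite /= ger0_norm//.
by rewrite ig ltry.
Qed.

Let Gamma_diff (t' t : R) : 0 <= t' <= t ->
  (\int[mu]_(u in `]t', t]) (gamma u)%:E = (Gamma t - Gamma t')%:E)%E.
Proof.
move=> /andP[t'0 t't]; have [_ mg [g0 _] ig _] := eb.
rewrite /Gamma Rintegral_itvB.
- rewrite /Rintegral fineK//; apply: integrable_fin_num => //.
  exact: integrable_gamma.
- exact: integrable_gamma.
- by rewrite bnd_simp.
- by rewrite bnd_simp.
Qed.

Let L : R := T + Gamma T.
(** Adding t to [Gamma] makes the increments of g strictly positive, as the bound l of
    [volterra_increment] must be; dividing by L makes g end at 1. *)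
Let g (t : R) : R := (t + Gamma t) / L.

Let Gamma_ge0 t : 0 <= Gamma t.
Proof. by have [_ _ [g0 _] _ _] := eb; apply: Rintegral_ge0. Qed.

Let L0 : 0 < L.
Proof. by rewrite ltr_wpDr. Qed.

Let Gamma_mono (t' t : R) : 0 <= t' <= t -> Gamma t' <= Gamma t.
Proof.
move=> h; rewrite -subr_ge0 -lee_fin -Gamma_diff//.
by have [_ _ [g0 _] _ _] := eb; apply: integral_ge0 => u _; rewrite lee_fin.
Qed.

Let Gamma0 : Gamma 0 = 0.
Proof. by rewrite /Gamma set_itv1 Rintegral_set1. Qed.

Let g0 : g 0 = 0.
Proof. by rewrite /g Gamma0 addr0 mul0r. Qed.

Let gT : g T = 1.
Proof. by rewrite /g divff// gt_eqF. Qed.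

Let cg : {within `[0, T], continuous g}.
Proof.
have := parameterized_integral_continuous (ltW T0) (integrable_gamma (measurable_itv _)).
move=> cG t; apply: cvgMl; apply: cvgD; last exact: cG.
exact: (@continuous_subspaceT _ _ `[0, T]%classic (@idfun R) (fun x => cvg_id)).
Qed.

Let g01 t : 0 <= t <= T -> 0 <= g t <= 1.
Proof.
move=> /andP[t0 tT]; rewrite divr_ge0 ?(ltW L0) ?addr_ge0 ?Gamma_ge0//=.
by rewrite ler_pdivrMr// mul1r lerD// Gamma_mono// t0.
Qed.

Lemma volterra_process_moment (X : R -> {RV P >-> R}) : 0 < y ->
  (forall t, 0 <= t <= T -> is_wiener_integral W t (volterra a b c t) (X t)) ->
  exists m C, [/\ (0 < m)%N, 0 <= C & forall s t, 0 <= s <= T -> 0 <= t <= T ->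
    (\int[P]_w ((X t w - X s w) ^+ m.*2)%:E <= (C * (g t - g s) ^+ 4)%:E)%E].
Proof.
move=> y0 hX.
(* m > 2 / y, so that 2my >= 4, the power of the increment of g in the moment condition. *)
pose m := (Num.bound (2 / y)).+1.
have my : 4 <= y * m.*2%:R.
  have h : 2 / y < m%:R.
    have := archi_boundP (divr_ge0 (ler0n R 2) (ltW y0)) => /lt_trans; apply.
    by rewrite ltr_nat.
  move: h; rewrite ltr_pdivrMr// -muln2 natrM => h; lra.
have [C C0 HC] := wiener_integral_moment hW m.
pose C' := C * (4 * K) ^+ m * (L `^ y) ^+ m.*2.
have C'0 : 0 <= C'.
  apply: mulr_ge0; last exact/exprn_ge0/powR_ge0.
  apply: mulr_ge0; first exact: ltW.
  by apply: exprn_ge0; apply: mulr_ge0 => //; exact: ltW.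
exists m, C'; split => // s t.
wlog st : s t / s < t => [H sT tT|].
  have [st|ts|->] := ltgtP s t; first exact: H.
    rewrite (_ : (g t - g s) ^+ 4 = (g s - g t) ^+ 4); last by rewrite -opprB; ring.
    rewrite (_ : (\int[P]_w _ = \int[P]_w ((X s w - X t w) ^+ m.*2)%:E)%E); last first.
      by apply: eq_integral => w _; rewrite -mul2n !exprM -[X t w - X s w]opprB sqrrN.
    exact: H.
  rewrite integral0_eq; last by move=> w _; rewrite subrr expr0n double_eq0.
  by rewrite lee_fin subrr expr0n mulr0.
move=> /andP[s0 sT] /andP[t0 tT].
have Gst : Gamma s <= Gamma t by rewrite Gamma_mono// s0 ltW.
pose h := g t - g s.
have hE : L * h = (t - s) + (Gamma t - Gamma s).
  by rewrite /h /g; field; rewrite gt_eqF.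
have Lh0 : 0 < L * h by rewrite hE ltr_wpDr ?subr_gt0// subr_ge0.
have h0 : 0 < h by move: Lh0; rewrite pmulr_rgt0.
have h1 : h <= 1.
  have /andP[_ gt1] : 0 <= g t <= 1 by apply: g01; rewrite t0.
  have /andP[gs0 _] : 0 <= g s <= 1 by apply: g01; rewrite s0.
  by rewrite /h; lra.
have inc := volterra_increment ma mb mc ea eb ec xx yy zz xyz (t' := s) (t := t) (l := L * h).
have {}inc := inc _ tT Lh0 _.
have {inc}Hinc : (\int[mu]_u (((volterra a b c t \_ `[0, t]) u -
    (volterra a b c s \_ `[0, s]) u) ^+ 2)%:E <= (K * ((L * h) `^ y) ^+ 2)%:E)%E.
  apply: inc; first by rewrite s0 ltW.
  rewrite Gamma_diff ?s0 ?(ltW st)// lee_fin hE lerDr subr_ge0 ltW//.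
(* The factor 4 matches the v / 4 in [wiener_integral_moment]. *)
pose v := 4 * (K * ((L * h) `^ y) ^+ 2).
have v0 : 0 < v.
  by apply: mulr_gt0 => //; apply: mulr_gt0 => //; exact/exprn_gt0/powR_gt0.
have t0T : 0 <= t <= T by rewrite t0.
have s0T : 0 <= s <= T by rewrite s0.
have := HC _ _ _ _ _ _ v (hX t t0T) (hX s s0T) v0.
rewrite {1}/v mulrC mulKf// => /(_ Hinc)/le_trans; apply.
rewrite lee_fin /C' /v; apply: powR_moment_bound => //; [exact: ltW|exact: ltW|by rewrite h0].
Qed.

Lemma volterra_modification (X : R -> {RV P >-> R}) : 0 < y ->
  (forall t, 0 <= t <= T -> is_wiener_integral W t (volterra a b c t) (X t)) ->
  exists Y : R -> {RV P >-> R}, modification_on `[0, T] X Y /\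
    forall w, {within `[0, T], continuous (fun t : R => Y t w)}.
Proof.
move=> y0 hX; have [m [C [m0 C0 EX]]] := volterra_process_moment y0 hX.
exact: (kolmogorov_continuity T0 cg g01 g0 gT m0 C0 EX).
Qed.

End assembly.

Theorem theorem1 (R : realType) (d : measure_display) (Omega : measurableType d)
    (P : probability Omega R) (W : R -> {RV P >-> R}) (hW : wiener_process W)
    (T : R) (hT : 0 < T) (a b c : R -> R) (p q r : \bar R)
    (hp : (2%:E <= p)%E) (hq : (1%:E <= q)%E) (hr : (1%:E <= r)%E)
    (ha : Lp_on `[0, T] p a) (hb : Lp_on `[0, T] q b) (hc : Lp_on `[0, T] r c)
    (hpqr : (p^-1 + q^-1 + r^-1 <= (3 / 2)%:E)%E) :
  [/\ forall t : R, 0 <= t <= T ->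
        {ae @lebesgue_measure R, forall s : R, (0 <= s <= t)%R ->
          (@lebesgue_measure R).-integrable `[s, t]
            (fun u => (b u * c (u - s)%R)%:E)} /\
        Lp_on `[0, t] 2%:E (volterra a b c t),
      (ereal_sup [set norm2_on `[0%R, t] (volterra a b c t) | t in `[0%R, T]]
        < +oo)%E,
      exists X : R -> {RV P >-> R}, forall t : R, 0 <= t <= T ->
        is_wiener_integral W t (volterra a b c t) (X t) /\
        forall Y : {RV P >-> R},
          is_wiener_integral W t (volterra a b c t) Y ->
          {ae P, forall w, Y w = X t w} &
      (p^-1 + r^-1 < (3 / 2)%:E)%E ->
      forall X : R -> {RV P >-> R},
        (forall t : R, 0 <= t <= T ->
          is_wiener_integral W t (volterra a b c t) (X t)) ->
        exists Y : R -> {RV P >-> R},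
          modification_on `[0, T] X Y /\
          forall w, {within `[0, T], continuous (fun t : R => Y t w)}].
Proof.
have mLp k f : Lp_on `[0, T] k f -> measurable_fun setT (f \_ `[0, T]).
  by rewrite /Lp_on inE => /andP[]; rewrite inE.
have [ma mb mc] := And3 (mLp _ _ ha) (mLp _ _ hb) (mLp _ _ hc).
have [px [pE pb]] := inve_bound (ltr0n R 2) hp.
have [qx [qE]] := inve_bound ltr01 hq; rewrite invr1 => qb.
have [rx [rE]] := inve_bound ltr01 hr; rewrite invr1 => rb.
rewrite -div1r in pb.
rewrite pE qE rE -!EFinD lee_fin in hpqr.
have [x [y [z [[xp yq zr] [xx yy zz] xyz y0]]]] := exists_exponents pb qb rb hpqr.
have p1 : (1%:E <= p)%E by apply: le_trans hp; rewrite lee_fin ler1n.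
have [Ma [beta ea]] := @Lp_envelope R T x p a hT p1 ltac:(by rewrite pE lee_fin) ha.
have [Mb [gamma eb]] := @Lp_envelope R T y q b hT hq ltac:(by rewrite qE lee_fin) hb.
have [Mc [delta ec]] := @Lp_envelope R T z r c hT hr ltac:(by rewrite rE lee_fin) hc.
have L2 t : 0 <= t <= T -> Lp_on `[0, t] 2%:E (volterra a b c t).
  exact: (Lp2_volterra ma mb mc ea eb ec xx yy zz xyz).
split.
- move=> t tT; split; last exact: L2.
  exact: (volterra_integrable mb mc ea eb ec xx yy zz xyz tT).
- apply: le_lt_trans (ltry (Num.sqrt (6 * (Ma * Mb * Mc) ^+ 2))).
  apply: ge_ereal_sup => _ [t /= tT <-].
  by apply: (norm2_volterra_le ma mb mc ea eb ec xx yy zz xyz); move: tT; rewrite in_itv.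
- have /choice[X HX] t : exists X : {RV P >-> R},
      0 <= t <= T -> is_wiener_integral W t (volterra a b c t) X.
    have [tT|tT] := boolP (0 <= t <= T); last by exists (W 0).
    have /andP[t0 _] := tT.
    by have [Y HY] := wiener_integral_exists hW t0 (L2 t tT); exists Y.
  exists X => t tT; split; first exact: HX.
  by move=> Y HY; exact: wiener_integral_unique hW _ _ _ _ HY (HX t tT).
- rewrite pE rE -EFinD lte_fin => /y0 {}y0 X hX.
  exact: (volterra_modification hW hT ma mb mc ea eb ec xx yy zz xyz y0 hX).
Qed.
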